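(* Let $\hat N$ be a compensated Poisson measure on $(Z,\mathcal Z)$ with non-atomic control measure $\nu$. Fix $k\ge1$ and integers $n_1,\dots,n_k\ge1$, let $n=n_1+\cdots+n_k$, and let $\pi^*=\{\{1,\dots,n_1\},\{n_1+1,\dots,n_1+n_2\},\dots,\{n_1+\cdots+n_{k-1}+1,\dots,n\}\}\in\mathcal P([n])$. Then, for any vector of functions $(f_1,\dots,f_k)$ such that $f_j\in\mathcal E_{s,0}(\nu^{n_j})$, $j=1,\dots,k$, the following relations hold: 1. If $\mathcal M_{\ge2}([n],\pi^* )=\varnothing$, then $\chi(I^{\hat N}_{n_1}(f_1),\dots,I^{\hat N}_{n_k}(f_k))=0$. 2. If $\mathcal M_{\ge2}([n],\pi^* )\neq\varnothing$, then $$\chi\left(I^{\hat N}_{n_1}(f_1),\dots,I^{\hat N}_{n_k}(f_k)\right)=\sum_{\sigma\in\mathcal M_{\ge2}([n],\pi^* )}\int_{Z^{|\sigma|}}f_{\sigma,k}\,d\nu^{|\sigma|},$$ where $f_{\sigma,k}$ is the function of $|\sigma|$ variables obtained by identifying the variables $x_i$ and $x_j$ in the argument of $f_1\otimes_0\cdots\otimes_0f_k$ if and only if $i\sim_\sigma j$. 3. If $\mathcal M^0_{\ge2}([n],\pi^* )=\varnothing$, then $\mathbb E(I^{\hat N}_{n_1}(f_1)\cdots I^{\hat N}_{n_k}(f_k))=0$. 4. If $\mathcal M^0_{\ge2}([n],\pi^* )\neq\varnothing$, then $$\mathbb E\left(I^{\hat N}_{n_1}(f_1)\cdots I^{\hat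 N}_{n_k}(f_k)\right)=\sum_{\sigma\in\mathcal M^0_{\ge2}([n],\pi^* )}\int_{Z^{|\sigma|}}f_{\sigma,k}\,d\nu^{|\sigma|},$$ with $f_{\sigma,k}$ obtained by the same identification rule.
   Context: $(Z,\mathcal Z)$ is a Polish space with its Borel $\sigma$-field, $\nu$ a positive, $\sigma$-finite, non-atomic measure, $\mathcal Z_\nu=\{B\in\mathcal Z:\nu(B)<\infty\}$. A compensated (centered) Poisson measure with control $\nu$ is a family $\hat N=\{\hat N(B):B\in\mathcal Z_\nu\}$ of random variables such that: $\hat N(B)$ has the law of $N(B)-\nu(B)$ with $N(B)$ a Poisson random variable of parameter $\nu(B)$; $\hat N(B_1),\dots,\hat N(B_m)$ are independent for disjoint $B_1,\dots,B_m\in\mathcal Z_\nu$; and $\mathbb E[\hat N(B)\hat N(C)]=\nu(B\cap C)$. $\mathcal E_{s,0}(\nu^m)$ is the set of finite real linear combinations of indicators of sets $\widetilde C=\bigcup_{w\in\mathfrak S_m}C_{w(1)}\times\cdots\times C_{w(m)}$ with $C_1,\dots,C_m\in\mathcal Z_\nu$ pairwise disjoint ($\mathfrak S_m$ the permutations of $\{1,\dots,m\}$). The multiple Wiener-Itô integral $I^{\hat N}_m$ is the linear operator on $\mathcal E_{s,0}(\nu^m)$ given by $I^{\hat N}_m(\mathbf 1_{\widetilde C})=m!\,\hat N(C_1)\cdots\hat N(C_m)$. $[n]=\{1,\dots,n\}$; $\mathcal P([n])$ is the lattice of partitions of $[n]$ ($\sigma\le\pi$ iff each block of $\sigma$ is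 contained in a block of $\pi$), with meet $\wedge$, join $\vee$, $\hat0$ the partition into singletons, $\hat1=\{[n]\}$; $|\sigma|$ is the number of blocks of $\sigma$; $i\sim_\sigma j$ means $i,j$ are in the same block of $\sigma$. Define $$\mathcal M_{\ge2}([n],\pi^* )=\{\sigma\in\mathcal P([n]):\sigma\vee\pi^*=\hat1,\ \sigma\wedge\pi^*=\hat0,\ |b|\ge2\ \forall b\in\sigma\},$$ $$\mathcal M^0_{\ge2}([n],\pi^* )=\{\sigma\in\mathcal P([n]):\sigma\wedge\pi^*=\hat0,\ |b|\ge2\ \forall b\in\sigma\}.$$ $f_1\otimes_0\cdots\otimes_0f_k(x_1,\dots,x_n)=\prod_{j=1}^kf_j(x_{n_1+\cdots+n_{j-1}+1},\dots,x_{n_1+\cdots+n_j})$. Joint cumulant: $\chi(X_1,\dots,X_k)=(-i)^k\frac{\partial^k}{\partial z_1\cdots\partial z_k}\log\mathbb E[\exp(i\sum_\ell z_\ell X_\ell)]\big|_{z=0}$. *)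

(* Defs.v *)
From HB Require Import structures.
From mathcomp Require Import all_boot all_order all_algebra all_fingroup.

Set Implicit Arguments.
Unset Strict Implicit.
Unset Printing Implicit Defensive.

(** * The lattice of partitions of a finite type *)

Section partition_lattice.
Context {T : finType}.
Implicit Types s p t : {set {set T}}.

Definition partition_le s p :=
  [forall (b | b \in s), exists (c | c \in p), b \subset c].

Definition partition_meet s p : {set {set T}} :=
  ([set b :&: c | b in s, c in p] :\ set0).

(* The classes of the equivalence relation generated by "same block of s or
   same block of p". *)
Definition partition_join s p : {set {set T}} :=
  equivalence_partition
    (connect [rel i j | (j \in pblock s i) || (j \in pblock p i)])
    [set: T].

Definition partition_bot : {set {set T}} := [set [set i] | i : T].

Definition partition_top : {set {set T}} := [set [set: T]].

Definition partitions_ge2_meet0 p : {set {set {set T}}} :=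
  [set s | [&& partition s [set: T],
    partition_meet s p == partition_bot &
    [forall (b | b \in s), 2 <= #|b|]%N]].

Definition partitions_ge2 p : {set {set {set T}}} :=
  [set s in partitions_ge2_meet0 p | partition_join s p == partition_top].

Lemma partition_leP s p : partition s [set: T] -> partition p [set: T] ->
  reflect (forall i j, j \in pblock s i -> j \in pblock p i) (partition_le s p).
Proof.
move=> sT pT; have [/eqP covs trs s0] := and3P sT.
have [/eqP covp trp p0] := and3P pT.
apply: (iffP forall_inP) => [sp i j jsi|sp b bs].
  have ics : i \in cover s by rewrite covs inE.
  have /exists_inP[c cp bc] := sp _ (pblock_mem ics).
  have ic : i \in c by apply: (subsetP bc); rewrite mem_pblock.
  by rewrite (def_pblock trp cp ic); exact: (subsetP bc).
have [b0|[i ib]] := set_0Vmem b; first by rewrite b0 (negbTE s0) in bs.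
have icp : i \in cover p by rewrite covp inE.
apply/exists_inP; exists (pblock p i); first exact: pblock_mem.
by apply/subsetP => j jb; apply: sp; rewrite (def_pblock trs bs ib).
Qed.

Lemma partition_meetP s p :
  partition s [set: T] -> partition p [set: T] ->
  [/\ partition (partition_meet s p) [set: T],
      partition_le (partition_meet s p) s, partition_le (partition_meet s p) p &
      forall t, partition t [set: T] ->
        partition_le t s -> partition_le t p ->
        partition_le t (partition_meet s p)].
Proof.
move=> sT pT; have [/eqP covs trs s0] := and3P sT.
have [/eqP covp trp p0] := and3P pT.
have memm i : (pblock s i :&: pblock p i) \in partition_meet s p.
  rewrite !inE; apply/andP; split.
    by apply/set0Pn; exists i; rewrite inE !mem_pblock covs covp !inE.
  apply/imset2P; exists (pblock s i) (pblock p i) => //;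
    by apply: pblock_mem; rewrite (covs, covp) inE.
split.
- apply/and3P; split.
  + apply/eqP/setP => i; rewrite inE; apply/bigcupP.
    exists (pblock s i :&: pblock p i) => //.
    by rewrite inE !mem_pblock covs covp !inE.
  + apply/trivIsetP => A B; rewrite !inE => /andP[_ /imset2P[a a' sa pa ->]].
    move=> /andP[_ /imset2P[b b' sb pb ->]] ne.
    rewrite -setI_eq0; apply: contraNT ne => /set0Pn[i].
    rewrite !inE => /andP[/andP[ia ia'] /andP[ib ib']].
    rewrite -(def_pblock trs sa ia) -(def_pblock trs sb ib).
    by rewrite -(def_pblock trp pa ia') -(def_pblock trp pb ib').
  + by rewrite !inE eqxx.
- apply/forall_inP => b; rewrite !inE => /andP[_ /imset2P[a c sa pc ->]].
  by apply/exists_inP; exists a => //; exact: subsetIl.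
- apply/forall_inP => b; rewrite !inE => /andP[_ /imset2P[a c sa pc ->]].
  by apply/exists_inP; exists c => //; exact: subsetIr.
- move=> t tT /(partition_leP tT sT) ts /(partition_leP tT pT) tp.
  have [/eqP covt trt t0] := and3P tT.
  apply/forall_inP => b bt.
  have [b0|[i ib]] := set_0Vmem b; first by rewrite b0 (negbTE t0) in bt.
  apply/exists_inP; exists (pblock s i :&: pblock p i) => //.
  apply/subsetP => j jb.
  by rewrite inE ts ?tp// (def_pblock trt bt ib).
Qed.

Lemma partition_joinP s p :
  partition s [set: T] -> partition p [set: T] ->
  [/\ partition (partition_join s p) [set: T],
      partition_le s (partition_join s p), partition_le p (partition_join s p) &
      forall t, partition t [set: T] ->
        partition_le s t -> partition_le p t ->
        partition_le (partition_join s p) t].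
Proof.
move=> sT pT; have [/eqP covs trs s0] := and3P sT.
have [/eqP covp trp p0] := and3P pT.
set e := [rel i j | (j \in pblock s i) || (j \in pblock p i)].
have esym : connect_sym e.
  apply: sym_connect_sym => i j /=.
  by rewrite -!eq_pblock ?covs ?covp ?inE// ![_ == pblock _ i]eq_sym.
have eqv : {in [set: T] & &, equivalence_rel (connect e)}.
  move=> x y z _ _ _; split; first exact: connect0.
  by move=> xy; rewrite (same_connect esym xy).
have jT : partition (partition_join s p) [set: T].
  exact: equivalence_partitionP.
have jE i j : (j \in pblock (partition_join s p) i) = connect e i j.
  by rewrite pblock_equivalence_partition ?inE.
split => //.
- by apply/(partition_leP sT jT) => i j ij; rewrite jE connect1//= ij.
- by apply/(partition_leP pT jT) => i j ij; rewrite jE connect1//= ij orbT.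
- move=> t tT /(partition_leP sT tT) st /(partition_leP pT tT) pt.
  have [/eqP covt trt t0] := and3P tT.
  apply/(partition_leP jT tT) => i j; rewrite jE => /connectP[q].
  elim: q i => [|k q IH] i /=.
    by move=> _ ->; rewrite mem_pblock covt inE.
  move=> /andP[ik kq] jl; have := IH _ kq jl.
  have : k \in pblock t i by case/orP: ik => [/st|/pt].
  by move=> /(same_pblock trt) ->.
Qed.

End partition_lattice.

(* The classical sets library, imported from here on, rebinds [partition],
   [trivIset] and [cover]. *)
From mathcomp Require Import all_classical all_reals all_analysis.
From mathcomp.real_closed Require Import complex.

Import Order.TTheory GRing.Theory Num.Theory.
Import numFieldNormedType.Exports.

Local Open Scope classical_set_scope.
Local Open Scope ring_scope.

(** * Spaces and measures *)

Definition metrizes (R : realType) (T : topologicalType) (d : T -> T -> R) :=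
  [/\ forall x y, d x y = 0 <-> x = y,
      forall x y, d x y = d y x,
      forall x y z, d x z <= d x y + d y z &
      forall x (A : set T), nbhs x A <->
        exists2 e : R, 0 < e & [set y | d x y < e] `<=` A].

Definition complete_distance (R : realType) (T : topologicalType)
    (d : T -> T -> R) :=
  forall u : nat -> T,
    (forall e, 0 < e ->
      exists N, forall i j, (N <= i)%N -> (N <= j)%N -> d (u i) (u j) < e) ->
    exists l : T, u @ \oo --> l.

Definition polish (R : realType) (T : topologicalType) :=
  (exists2 D : set T, countable D & dense D) /\
  exists d : T -> T -> R, metrizes d /\ complete_distance d.

Definition borel (Z : ptopologicalType) := g_sigma_algebraType (@open Z).

HB.instance Definition _ (Z : ptopologicalType) := Measurable.on (borel Z).

Definition non_atomic d (T : measurableType d) (R : realType)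
    (nu : set T -> \bar R) :=
  forall A, measurable A -> (0 < nu A)%E ->
    exists B, [/\ measurable B, B `<=` A, (0 < nu B)%E & (nu B < nu A)%E].

Definition finite_sets d (T : measurableType d) (R : realType)
    (nu : set T -> \bar R) : set (set T) :=
  [set B | measurable B /\ (nu B < +oo)%E].

(** * Powers of a sigma-finite measure *)

Section measure_cons.
Context d (T : measurableType d) (R : realType) (n : nat).
Variable nu : {sigma_finite_measure set T -> \bar R}.
Variable mu : {sigma_finite_measure set (n.-tuple T) -> \bar R}.

Let cons_pair (x : T * n.-tuple T) : n.+1.-tuple T := [tuple of x.1 :: x.2].

Definition measure_cons : set (n.+1.-tuple T) -> \bar R :=
  pushforward (nu \x mu)%E cons_pair.

Let mcons : measurable_fun [set: T * n.-tuple T] cons_pair.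
Proof. exact: measurable_cons. Qed.

Let mcons0 : measure_cons set0 = 0%E.
Proof. by rewrite /measure_cons /pushforward preimage_set0 measure0. Qed.

Let mcons_ge0 A : (0 <= measure_cons A)%E.
Proof. exact: measure_ge0. Qed.

Let mcons_sigma_additive : semi_sigma_additive measure_cons.
Proof.
move=> F mF tF mUF; rewrite /measure_cons /pushforward preimage_bigcup.
apply: measure_semi_sigma_additive.
- by move=> i; rewrite -[X in measurable X]setTI; exact: mcons.
- apply/trivIsetP => /= i j _ _ ij; rewrite -preimage_setI.
  by move/trivIsetP : tF => /(_ _ _ _ _ ij) ->//; rewrite preimage_set0.
- by rewrite -preimage_bigcup -[X in measurable X]setTI; exact: mcons.
Qed.

HB.instance Definition _ := isMeasure.Build _ _ _ measure_cons
  mcons0 mcons_ge0 mcons_sigma_additive.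

Lemma measure_consE (A : set T) (B : set (n.-tuple T)) :
  measurable A -> measurable B ->
  measure_cons [set t | A (thead t) /\ B [tuple of behead t]] =
  (nu A * mu B)%E.
Proof.
move=> mA mB; rewrite -product_measure1E// /measure_cons /pushforward.
have beheadK x (t : n.-tuple T) :
    [tuple of behead [tuple of x :: t]] = t :> n.-tuple T by exact/val_inj.
congr (_ _); apply/seteqP; split => -[x t] /=; rewrite theadE.
  by move=> -[Ax]; rewrite beheadK.
by move=> [Ax Bt]; rewrite beheadK.
Qed.

Let mcons_sigma_finite : sigma_finite setT measure_cons.
Proof.
have /sigma_finiteP[F [TF ndF Foo]] := sigma_finiteT nu.
have /sigma_finiteP[G [TG ndG Goo]] := sigma_finiteT mu.
exists (fun k => [set t : n.+1.-tuple T |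
    F k (thead t) /\ G k [tuple of behead t]]).
  rewrite predeqE => t; split=> // _.
  have [i _ Fi] : (\bigcup_k F k) (thead t) by rewrite -TF.
  have [j _ Gj] : (\bigcup_k G k) [tuple of behead t] by rewrite -TG.
  exists (maxn i j) => //; split.
    by move: Fi; exact/subsetPset/ndF/leq_maxl.
  by move: Gj; exact/subsetPset/ndG/leq_maxr.
move=> k; have [? ?] := Foo k; have [? ?] := Goo k; split.
  apply: measurableI.
    rewrite -[X in measurable X]setTI; apply: (measurable_tnth ord0) => //.
  by rewrite -[X in measurable X]setTI; exact: measurable_behead.
by rewrite measure_consE// lte_mul_pinfty// ge0_fin_numE.
Qed.

HB.instance Definition _ := Measure_isSigmaFinite.Build _ _ _ measure_cons
  mcons_sigma_finite.

End measure_cons.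

Fixpoint power_measure d (T : measurableType d) (R : realType)
    (nu : {sigma_finite_measure set T -> \bar R}) (n : nat) :
    {sigma_finite_measure set (n.-tuple T) -> \bar R} :=
  if n is m.+1 then measure_cons nu (power_measure nu m)
  else \d_([tuple] : 0.-tuple T).

Lemma power_measure_box d (T : measurableType d) (R : realType)
    (nu : {sigma_finite_measure set T -> \bar R}) (n : nat)
    (A : 'I_n -> set T) : (forall i, measurable (A i)) ->
  power_measure nu n [set t | forall i, A i (tnth t i)] =
  (\prod_(i < n) nu (A i))%E.
Proof.
elim: n A => [|n IH] A mA.
  rewrite big_ord0 /= diracE mem_set// => -[]//.
rewrite big_ord_recl -IH; last by move=> i; exact: mA.
rewrite -measure_consE//; last first.
  have -> : [set t : n.-tuple T | forall i, A (lift ord0 i) (tnth t i)] =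
      \bigcap_(i in [set: 'I_n]) ((@tnth _ T ^~ i) @^-1` A (lift ord0 i)).
    by apply/seteqP; split => t /= H i; [move=> _; exact: H|exact: H].
  apply: fin_bigcap_measurable => // i _.
  by rewrite -[X in measurable X]setTI; exact: measurable_tnth.
congr (measure_cons _ _ _); apply/seteqP; split => t /=.
- by move=> H; split => [|i]; [exact: H|rewrite tnth_behead; have := H (lift ord0 i);
    congr (A _ (tnth _ _)); apply/val_inj; rewrite /= inordK// ltnS].
- move=> [H0 H] i; case: (unliftP ord0 i) => [j ->|->//].
  have := H j; rewrite tnth_behead; congr (A _ (tnth _ _)).
  by apply/val_inj; rewrite /= inordK// ltnS.
Qed.

(** * Compensated Poisson measures and multiple Wiener-Ito integrals *)

Section compensated_poisson.
Context dO (Omega : measurableType dO) (R : realType)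
  (P : probability Omega R).

Definition independent_RVs (m : nat) (X : 'I_m -> {RV P >-> R}) :=
  forall A : 'I_m -> set R, (forall i, measurable (A i)) ->
    P (\bigcap_(i in [set: 'I_m]) (X i @^-1` A i)) =
    (\prod_(i < m) P (X i @^-1` A i))%E.

Context dZ (Z : measurableType dZ).

(* [N] is total on [set Z], but only its values on [finite_sets nu] are
   constrained. The last argument of [poisson_prob] is a dummy. *)
Record compensated_poisson_measure (nu : {measure set Z -> \bar R})
    (N : set Z -> {RV P >-> R}) : Prop := {
  compensated_poisson_law : forall B, finite_sets nu B ->
    let r := fine (nu B) in
    forall A : set R, measurable A ->
      distribution P (N B) A =
      pushforward (poisson_prob r 0%N) (fun k : nat => k%:R - r) A ;
  compensated_poisson_independent : forall (m : nat) (B : 'I_m -> set Z),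
    (forall i, finite_sets nu (B i)) -> trivIset [set: 'I_m] B ->
    independent_RVs (fun i => N (B i)) ;
  compensated_poisson_covariance : forall B C,
    finite_sets nu B -> finite_sets nu C ->
    ('E_P[(N B \* N C)%R] = nu (B `&` C))%E
}.

Definition symmetric_box (m : nat) (C : 'I_m -> set Z) : set (m.-tuple Z) :=
  \bigcup_(w in [set: 'S_m]) [set z | forall i, C (w i) (tnth z i)].

Definition admissible (nu : set Z -> \bar R) (m : nat) (C : 'I_m -> set Z) :=
  (forall i, finite_sets nu (C i)) /\ trivIset [set: 'I_m] C.

Definition elementary_symmetric (nu : set Z -> \bar R) (m : nat) :
    set (m.-tuple Z -> R) :=
  [set f | exists (r : nat) (a : 'I_r -> R) (C : 'I_r -> 'I_m -> set Z),
    (forall l, admissible nu (C l)) /\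
    forall z, f z = \sum_(l < r) a l * \1_(symmetric_box (C l)) z].

(* Random variables are identified when they are almost surely equal. *)
Record is_multiple_integral (nu : {measure set Z -> \bar R})
    (N : set Z -> {RV P >-> R}) (m : nat)
    (I : (m.-tuple Z -> R) -> {RV P >-> R}) : Prop := {
  multiple_integral_linear : forall (a : R) (f g : m.-tuple Z -> R),
    elementary_symmetric nu f -> elementary_symmetric nu g ->
    {ae P, forall w, I (fun z => a * f z + g z) w = a * I f w + I g w} ;
  multiple_integral_box : forall C : 'I_m -> set Z, admissible nu C ->
    {ae P, forall w, I \1_(symmetric_box C) w =
                     m`!%:R * \prod_(i < m) N (C i) w}
}.

End compensated_poisson.

(** * Joint cumulants *)

Section joint_cumulant.
Local Open Scope complex_scope.
Context {R : realType}.

(* Principal argument, with values in ]-pi, pi]; the value at 0 is 0. *)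
Definition carg (z : R[i]) : R :=
  let: x +i* y := z in
  if 0 < x then atan (y / x)
  else if x < 0 then
    if 0 <= y then atan (y / x) + pi else atan (y / x) - pi
  else if 0 < y then pi / 2 else if y < 0 then - (pi / 2) else 0.

Definition clog (z : R[i]) : R[i] :=
  ln (Num.sqrt (complex.Re z ^+ 2 + complex.Im z ^+ 2)) +i* carg z.

Definition cpartial (k : nat) (l : 'I_k) (g : 'rV[R]_k -> R[i]) :
    'rV[R]_k -> R[i] :=
  fun z => 'D_(delta_mx 0 l) (fun u => complex.Re (g u)) z +i*
           'D_(delta_mx 0 l) (fun u => complex.Im (g u)) z.

Definition mixed_partial (k : nat) (g : 'rV[R]_k -> R[i]) :
    'rV[R]_k -> R[i] :=
  foldr (@cpartial k) g (enum 'I_k).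

Context d (T : measurableType d) (P : probability T R).

Definition joint_char_fun (k : nat) (X : 'I_k -> T -> R) (z : 'rV[R]_k) :
    R[i] :=
  fine ('E_P[(fun w => cos (\sum_(l < k) z 0 l * X l w)%R)])%E +i*
  fine ('E_P[(fun w => sin (\sum_(l < k) z 0 l * X l w)%R)])%E.

Definition joint_cumulant (k : nat) (X : 'I_k -> T -> R) : R[i] :=
  (- 'i) ^+ k * mixed_partial (fun z => clog (joint_char_fun X z)) 0.

End joint_cumulant.

(** * Identification of variables *)

(* [tagnat.Rank j l] is the ordinal n_0 + ... + n_(j-1) + l, see
   [tagnat.RankEsum]. *)
Section identification.
Context (k : nat) (n_ : 'I_k -> nat).

Definition consecutive_blocks : {set {set 'I_(\sum_(j < k) n_ j)}} :=
  [set [set tagnat.Rank j l | l : 'I_(n_ j)]%SET | j : 'I_k]%SET.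

Context {R : realType} {Z : pointedType}.
Variable f : forall j : 'I_k, (n_ j).-tuple Z -> R.

Definition tensor (x : (\sum_(j < k) n_ j).-tuple Z) : R :=
  \prod_(j < k) f [tuple tnth x (tagnat.Rank j l) | l < n_ j].

(* The blocks of [s] are numbered by [enum s]; the default value [point] is
   never used when [s] is a partition of the whole index set. *)
Definition identify (s : {set {set 'I_(\sum_(j < k) n_ j)}})
    (y : #|s|.-tuple Z) : R :=
  tensor [tuple nth point y (index (finset.pblock s i) (enum s))
         | i < \sum_(j < k) n_ j].

End identification.

(* Main.v *)
(** By multilinearity everything reduces to products of values of [N].  If
    [D_i], [i] in a finite set [S], are sets of finite measure, then
    [E prod_(i in S) N (D_i)] is the sum over the partitions of [S] of
    [prod_b w b], where [w b] is [nu (bigcap_(i in b) D_i)] if [b] has at least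
    two elements and [0] otherwise.  Both sides satisfy
    [M S = sum_B w B * M (S \ B)], [B] ranging over the subsets of [S] that
    contain a fixed [x].  For sets [D_i] taken in a disjoint family this
    recursion is the Chen-Stein identity [E (K g(K)) = r E (g (K + 1))] of the
    Poisson law together with independence; it extends to arbitrary sets by
    cutting them into atoms, since [N] is additive almost surely (the
    covariances give a vanishing second moment).  No constraint relating the
    partition to [pi_star] is needed there: a block containing two indices of
    the same factor has weight [0], because the sets of a factor are disjoint.

    Joint cumulants are characterized by the same recursion on subsets of the
    factors, [M S = sum_B chi B * M (S \ B)]: this is the Leibniz rule for
    [phi = exp (log phi)].  On the combinatorial side, splitting off the
    connected component of a fixed factor shows that the sum over the
    partitions whose join with [pi_star] is the top satisfies it too. *)

Require Import Defs.
From HB Require Import structures.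
From mathcomp Require Import all_boot all_order all_algebra all_fingroup.

Set Implicit Arguments.
Unset Strict Implicit.
Unset Printing Implicit Defensive.

Import Order.TTheory GRing.Theory Num.Theory.

Local Open Scope ring_scope.

(** * Sums over set partitions *)

Section partition_sums.
Context {T : finType} {R : comNzRingType}.
Implicit Types (A U S : {set T}) (s : {set {set T}}).

(** Recursions are preferred to closed formulas because they pass through multilinear expansion:
    when the weights and moments attached to a subset depend only on the labels carried by that
    subset, a recursion valid for each labelling survives summation over all labellings. This serves
    twice, for cutting sets into atoms and for the product terms of the functions [f j]. The
    cumulant is defined by a principal logarithm and iterated partial derivatives. To iterate, each
    derivative must be known on a neighbourhood and not only at 0. It is therefore given explicitly,
    as a rational expression in the expectations of products of the [X j] times exp (i <z, X>), at
    all points where the characteristic function has positive real part. At 0 this expression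
    satisfies the recursion on moments, which has only one solution. Independence is given for
    events only; product moments are drawn from it through the discreteness of the centered Poisson
    law. *)

Lemma partition_setIpowerset s A U :
  partition s A -> (forall b, b \in s -> (b \subset U) || [disjoint b & U]) ->
  U \subset A -> partition (s ::&: U) U.
Proof.
move=> sA sU UA; have [/eqP cov tri n0] := and3P sA.
apply/and3P; split; last 1 first.
- by rewrite !inE (negbTE n0).
- rewrite eqEsubset; apply/andP; split.
    by apply: subset_trans (cover_setI _ _) _; exact: subsetIr.
  apply/subsetP => x xU.
  have xc : x \in cover s by rewrite cov (subsetP UA).
  apply/bigcupP; exists (pblock s x); last by rewrite mem_pblock.
  rewrite inE pblock_mem//=; have /orP[//|] := sU _ (pblock_mem xc).
  by move/pred0P/(_ x) => /=; rewrite mem_pblock xc xU.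
- exact: trivIsetI.
Qed.

(** A partition of [A] in which [U] is a union of blocks amounts to a partition of [U] together with
    one of [A :\: U]. The predicate [Q] only sees the part on [U], so the lemma serves both for a
    single prescribed block and for a connected component. *)
Lemma partition_big_split (w : {set T} -> R) A U (Q : pred {set {set T}}) :
  U \subset A ->
  \sum_(s | [&& partition s A, partition (s ::&: U) U & Q (s ::&: U)])
    \prod_(b in s) w b =
  (\sum_(s | partition s U && Q s) \prod_(b in s) w b) *
  (\sum_(s | partition s (A :\: U)) \prod_(b in s) w b).
Proof.
move=> UA; rewrite big_distrlr/= pair_big/=.
rewrite (reindex_onto (fun p : {set {set T}} * {set {set T}} => p.1 :|: p.2)
  (fun s => (s ::&: U, s :\: (s ::&: U)))) /=; last first.
  by move=> s _; apply/setP => b; rewrite !inE; case: (b \in s); case: (b \subset U).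
(* A nonempty block cannot lie on both sides, so the two halves can be recovered from their
   union. *)
have sub0 (b : {set T}) : b \subset U -> b \subset A :\: U -> b = set0.
  move=> bU bAU; apply/eqP; rewrite -subset0; apply/subsetP => x xb.
  by have := subsetP bAU _ xb; rewrite inE (subsetP bU _ xb).
apply: eq_big => [[s1 s2]/=|[s1 s2]/=].
  apply/idP/idP.
    move=> /andP[/and3P[sA sU Qs] /eqP[e1 e2]].
    rewrite e1 in sU Qs; rewrite sU Qs /=.
    have [/eqP cov tri n0] := and3P sA.
    have s12 b : b \in s2 -> b \notin s1.
      by move=> bs2; move: (bs2); rewrite -e2 e1 inE => /andP[].
    apply/and3P; split.
    - apply/eqP/setP => x; rewrite inE -cov; apply/bigcupP/andP.
        move=> [b b2 xb]; split; last first.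
          by apply/bigcupP; exists b => //; rewrite inE b2 orbT.
        apply/negP => xU; have := xU; rewrite -(cover_partition sU) => /bigcupP[c c1 xc].
        have := s12 _ b2.
        rewrite -(def_pblock tri _ xb) ?inE ?b2 ?orbT//.
        by rewrite (def_pblock tri _ xc) ?inE ?c1//.
      move=> [xU /bigcupP[b]]; rewrite inE => /orP[b1|b2] xb; last by exists b.
      by have := subsetP (partitionS sU b1) _ xb; rewrite (negbTE xU).
    - by apply: trivIsetS tri; exact: subsetUr.
    - by apply: contra n0; rewrite inE => ->; rewrite orbT.
  move=> /andP[/andP[s1U Qs] s2A].
  have e1 : (s1 :|: s2) ::&: U = s1.
    apply/setP => b; rewrite !inE; apply/andP/idP => [[/orP[//|b2] bU]|b1].
      by have := partition0 s2A; rewrite -(sub0 b bU (partitionS s2A b2)) b2.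
    by rewrite b1; split=> //; exact: partitionS s1U b1.
  have e2 : (s1 :|: s2) :\: s1 = s2.
    apply/setP => b; rewrite !inE; case: (boolP (b \in s1)) => //= b1.
    apply/esym/negP => b2.
    have := partition0 s2A.
    by rewrite -(sub0 b (partitionS s1U b1) (partitionS s2A b2)) b2.
  rewrite e1 e2 s1U Qs eqxx/= !andbT; apply/and3P; split.
  - rewrite /cover bigcup_setU -/(cover s1) -/(cover s2).
    rewrite (cover_partition s1U) (cover_partition s2A).
    apply/eqP/setP => x; rewrite !inE; case: (boolP (x \in U)) => // xU.
    by rewrite (subsetP UA).
  - apply: trivIsetU; [exact: partition_trivIset s1U|exact: partition_trivIset s2A|].
    rewrite (cover_partition s1U) (cover_partition s2A) -setI_eq0.
    by rewrite setIDA setIC -setIDA setDv setI0.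
  - by rewrite inE (partition0 s1U) (partition0 s2A).
move=> /andP[_ /eqP[e1 e2]].
rewrite (eq_bigl [predU s1 & s2]) => [|b]; last by rewrite !inE.
rewrite bigU//= disjoints_subset; apply/subsetP => b b1.
by rewrite inE -e2 e1 !inE b1.
Qed.

(** The moments-cumulants formula: if [w] gives the joint cumulants of the subfamilies, this is the
    joint moment over [A]. *)
Definition partition_sum (w : {set T} -> R) A :=
  \sum_(s | partition s A) \prod_(b in s) w b.

Lemma partition_sum0 w : partition_sum w set0 = 1.
Proof.
rewrite /partition_sum (big_pred1 set0) ?big_set0// => s.
by rewrite partition_set0.
Qed.

(** The partitions are sorted by the block [B] of [x]; the predicate of [partition_big_split] forces
    the part on [B] to be that single block. *)
Lemma partition_sum_rec w A x : x \in A ->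
  partition_sum w A =
  \sum_(B : {set T} | (B \subset A) && (x \in B)) w B * partition_sum w (A :\: B).
Proof.
move=> xA; rewrite /partition_sum.
rewrite (partition_big (fun s => pblock s x)
  (fun B : {set T} => (B \subset A) && (x \in B))) /=; last first.
  move=> s sA; have xc : x \in cover s by rewrite (cover_partition sA).
  by rewrite (partitionS sA (pblock_mem xc)) mem_pblock.
apply: eq_bigr => B /andP[BA xB].
have B0 : B != set0 by apply/set0Pn; exists x.
have pB : partition [set B] B.
  by rewrite /partition cover1 eqxx trivIset1 inE eq_sym /= B0.
have := @partition_big_split w A B (pred1 [set B]) BA.
rewrite [X in _ = X * _ -> _](big_pred1 [set B]) => [|s /=]; last first.
  by case: eqP => [->|_]; rewrite ?pB ?andbF.
rewrite big_set1 => <-; apply: eq_bigl => s.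
apply/andP/and3P => [[sA /eqP sB]|[sA sB /eqP e]].
  have [/eqP cov tri n0] := and3P sA.
  have Bs : B \in s by rewrite -sB pblock_mem// cov.
  have e : s ::&: B = [set B].
    apply/setP => b; rewrite !inE; apply/andP/eqP => [[bs bB]|->]; last by split.
    have [b0|[y yb]] := set_0Vmem b; first by rewrite b0 (negbTE n0) in bs.
    by rewrite -(def_pblock tri bs yb) (def_pblock tri Bs)// (subsetP bB).
  by rewrite /= e pB.
split=> //; apply/eqP/(def_pblock (partition_trivIset sA)) => //.
by have : B \in s ::&: B; [rewrite e set11|rewrite inE => /andP[]].
Qed.

Context {I : finType} (blk : T -> I).

(** Connectedness is read on the factors rather than on a join of partitions of [T], so that it also
    makes sense for partitions of the indices of some factors only. *)
Definition block_rel s : rel I :=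
  [rel j j' | [exists b in s, exists x in b, exists y in b,
    (blk x == j) && (blk y == j')]].

Definition block_connected (S : {set I}) s :=
  [forall j in S, forall j' in S, connect (block_rel s) j j'].

Definition connected_sum (w : {set T} -> R) (S : {set I}) :=
  \sum_(s | partition s (blk @^-1: S) && block_connected S s) \prod_(b in s) w b.

Lemma block_relP s j j' :
  reflect (exists b x y, [/\ b \in s, x \in b, y \in b, blk x = j & blk y = j'])
    (block_rel s j j').
Proof.
apply: (iffP exists_inP) => [[b bs /exists_inP[x xb /exists_inP[y yb /andP[/eqP jx /eqP
  jy]]]]|].
  by exists b, x, y.
move=> [b [x [y [bs xb yb <- <-]]]]; exists b => //; apply/exists_inP; exists x => //.
by apply/exists_inP; exists y => //; rewrite !eqxx.
Qed.

Lemma block_rel_sym s : connect_sym (block_rel s).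
Proof.
apply: sym_connect_sym => i j; apply/block_relP/block_relP;
  by move=> [b [x [y [? ? ? ? ?]]]]; exists b, y, x.
Qed.

(** The partitions are sorted by the component [B] of [j0]. A block that meets the indices of [B]
    lies within them, so these indices form a union of blocks and the component splits off. *)
Lemma partition_sum_connected (w : {set T} -> R) (S : {set I}) j0 : j0 \in S ->
  partition_sum w (blk @^-1: S) =
  \sum_(B : {set I} | (B \subset S) && (j0 \in B))
    connected_sum w B * partition_sum w (blk @^-1: (S :\: B)).
Proof.
move=> j0S; pose comp s := [set j | connect (block_rel s) j0 j].
rewrite /partition_sum (partition_big comp
  (fun B : {set I} => (B \subset S) && (j0 \in B))) /=; last first.
  move=> s sA; rewrite inE connect0 andbT; apply/subsetP => j; rewrite inE => cj.
  have cl : fingraph.closed (block_rel s) S.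
    apply: (intro_closed (block_rel_sym s)) => x y /block_relP[b [u [v [bs ub vb <-
      <-]]]] _.
    by have := subsetP (partitionS sA bs) _ vb; rewrite inE.
  by rewrite -(closed_connect cl cj).
apply: eq_bigr => B /andP[BS j0B].
rewrite preimsetD -partition_big_split ?preimsetS//.
apply: eq_bigl => s; apply/andP/and3P.
  move=> [sA /eqP eB].
  have [/eqP cov tri n0] := and3P sA.
  have dich b x : b \in s -> x \in b -> blk x \in B -> b \subset blk @^-1: B.
    move=> bs xb; rewrite -eB inE => cx; apply/subsetP => y yb; rewrite !inE.
    apply: (connect_trans cx); apply: connect1; apply/block_relP.
    by exists b, x, y.
  split => //.
    apply: (partition_setIpowerset sA); last exact: preimsetS.
    move=> b bs; case: (boolP (b \subset _)) => //= nb.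
    apply/pred0P => x /=; apply/negP => /andP[xb xB]; case/negP: nb.
    by apply: (dich _ x) => //; rewrite inE in xB.
  (* A chain starting at [j0] never leaves its component, so it only uses blocks inside
     [blk @^-1: B]. *)
  have H j : j \in B -> connect (block_rel (s ::&: blk @^-1: B)) j0 j.
    rewrite -{1}eB inE => cj.
    have cl : fingraph.closed (block_rel s)
       [set j | (j \in B) && connect (block_rel (s ::&: blk @^-1: B)) j0 j].
      apply: (intro_closed (block_rel_sym s)) => x y xy.
      rewrite !inE => /andP[xB cx]; have [b [u [v [bs ub vb ux vy]]]] := block_relP _ _
        _ xy.
      have bB : b \subset blk @^-1: B by apply: (dich _ u) => //; rewrite ux.
      have -> : y \in B by have := subsetP bB _ vb; rewrite inE vy.
      apply: connect_trans cx _; apply: connect1; apply/block_relP.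
      by exists b, u, v; rewrite inE bs bB.
    have := closed_connect cl cj; rewrite !inE connect0 j0B /=.
    by move=> /esym/andP[].
  apply/forall_inP => j jB; apply/forall_inP => j' jB'.
  by apply: connect_trans (H _ jB'); rewrite block_rel_sym; exact: H.
move=> [sA sB /forall_inP cB]; split => //; apply/eqP/setP => j; rewrite inE.
have [/eqP cov tri n0] := and3P sA.
apply/idP/idP => [cj|jB]; last first.
  have /forall_inP/(_ _ jB) := cB _ j0B.
  apply: connect_sub => x y /block_relP[b [u [v [bs ub vb ux vy]]]].
  apply: connect1; apply/block_relP; exists b, u, v; split => //.
  by move: bs; rewrite inE => /andP[].
(* Conversely, when the indices of [B] form a union of blocks, no chain leaves [B]. *)
have cl : fingraph.closed (block_rel s) B.
  apply: (intro_closed (block_rel_sym s)) => x y /block_relP[b [u [v [bs ub vb ux vy]]]] xB.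
  have : u \in cover (s ::&: blk @^-1: B).
    by rewrite (cover_partition sB) inE ux.
  move=> /bigcupP[c]; rewrite inE => /andP[cs cB'] uc.
  have bc : b = c by rewrite -(def_pblock tri bs ub) (def_pblock tri cs uc).
  by rewrite -vy; have := subsetP cB' v; rewrite -bc inE; apply.
by rewrite -(closed_connect cl cj).
Qed.

(** Chains for the join mix steps inside a block of [s] with steps inside a factor; [blk] contracts
    the latter, and edges of [block_rel] lift back. The point [x0] excludes the empty type, where
    the join has no block but the top partition has one. *)
Lemma partition_join_connected s (p : {set {set T}}) (x0 : T) :
  (forall x y, (y \in pblock p x) = (blk x == blk y)) ->
  (forall j, exists x, blk x = j) ->
  partition s [set: T] ->
  (partition_join s p == partition_top) = block_connected [set: I] s.
Proof.
move=> pE surj sT; have [/eqP cov tri n0] := and3P sT.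
set e := [rel i j | (j \in pblock s i) || (j \in pblock p i)].
have esym : connect_sym e.
  apply: sym_connect_sym => i j /=.
  by rewrite -eq_pblock ?cov ?inE// eq_sym eq_pblock ?cov ?inE// !pE eq_sym.
have eqv : {in [set: T] & &, equivalence_rel (connect e)}.
  by move=> x y z _ _ _; split; [exact: connect0|move=> xy; rewrite (same_connect esym xy)].
have jT : partition (partition_join s p) [set: T] by exact: equivalence_partitionP.
have jE i j : (j \in pblock (partition_join s p) i) = connect e i j.
  by rewrite pblock_equivalence_partition ?inE.
have -> : (partition_join s p == partition_top) = [forall x, forall y, connect e x y].
  apply/eqP/'forall_forallP => [H x y|H].
    rewrite -jE H /partition_top (@def_pblock _ _ [set: T]) ?inE//.
    exact: trivIset1.
  have HT x : pblock (partition_join s p) x = [set: T].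
    by apply/setP => y; rewrite jE inE H.
  have [/eqP jcov jtri jn0] := and3P jT.
  apply/setP => b; rewrite !inE; apply/idP/eqP => [bj|->].
    have [b0|[y yb]] := set_0Vmem b; first by rewrite b0 (negbTE jn0) in bj.
    by rewrite -(def_pblock jtri bj yb).
  by rewrite -(HT x0) pblock_mem// jcov.
have s1 x y : y \in pblock s x -> block_rel s (blk x) (blk y).
  move=> yx; apply/block_relP; exists (pblock s x), x, y; split => //.
    by rewrite pblock_mem// cov.
  by rewrite mem_pblock cov.
apply/'forall_forallP/forall_inP => [H j _|H x y].
  apply/forall_inP => j' _; have [x <-] := surj j; have [y <-] := surj j'.
  have /connectP[q] := H x y.
  elim: q x => [|z q IH] x /=; first by move=> _ ->.
  move=> /andP[xz zq] yl; apply: connect_trans (IH _ zq yl).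
  by move: xz; rewrite pE => /orP[/s1/connect1//|/eqP->].
have /forall_inP/(_ (blk y)) := H (blk x) (in_setT _).
rewrite inE => /(_ isT)/connectP[q].
elim: q x => [|j q IH] x /=.
  by move=> _ /eqP yx; apply: connect1; rewrite /e /= pE eq_sym yx orbT.
move=> /andP[/block_relP[b [u [v [bs ub vb ux vj]]]] jq] yl.
rewrite -vj in jq yl; apply: connect_trans (IH _ jq yl).
apply: (@connect_trans _ _ u); first by apply: connect1; rewrite /= pE ux eqxx orbT.
by apply: connect1; rewrite /= (def_pblock tri bs ub) vb.
Qed.

End partition_sums.

Section partition_sum_unique.
Context {T : finType} {R : comNzRingType}.

(** Since [x] lies in [B], the set [A :\: B] is smaller than [A], so the recursion determines
    [M]. *)
Lemma partition_sum_unique (w M : {set T} -> R) : M set0 = 1 ->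
  (forall (A : {set T}) x, x \in A -> M A =
    \sum_(B : {set T} | (B \subset A) && (x \in B)) w B * M (A :\: B)) ->
  forall A, M A = partition_sum w A.
Proof.
move=> M0 Mrec A; have [n] := ubnP #|A|; elim: n A => // n IH A An.
have [->|[x xA]] := set_0Vmem A; first by rewrite partition_sum0.
rewrite (Mrec _ x)// (partition_sum_rec _ xA); apply: eq_bigr => B /andP[BA xB].
rewrite IH// -ltnS; apply: leq_trans An; rewrite ltnS; apply: proper_card.
rewrite properEneq subsetDl andbT; apply/eqP => /setP/(_ x).
by rewrite inE xB xA.
Qed.

End partition_sum_unique.

(** * Sums over labellings, weighted by products *)

Section weighted_sums.
Context {I E : finType} {R : comNzRingType} (e0 : E) (a : I -> E -> R).
Implicit Types (S B : {set I}) (f g : {ffun I -> E}) (phi : {ffun I -> E} -> R).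

Definition supported S f := [forall i, (i \in S) || (f i == e0)].

(* The functions are normalized to [e0] outside [S], so that [S] is the only
   set of indices that is summed over. *)
Definition weighted_sum S phi :=
  \sum_(f | supported S f) (\prod_(i in S) a i (f i)) * phi f.

Definition depends_on S phi := forall f g, {in S, f =1 g} -> phi f = phi g.

Lemma supportedP S f : reflect (forall i, i \notin S -> f i = e0) (supported S f).
Proof.
apply: (iffP forallP) => [H i iS|H i]; first by have := H i; rewrite (negbTE iS) => /eqP.
by have [//|/H->] := boolP (i \in S); rewrite eqxx.
Qed.

(** A labelling of [S] is a pair of labellings of [B] and [S :\: B]. Both are extended by [e0], so
    gluing ([h]) and restricting ([h']) are inverse to each other. *)
Lemma weighted_sum_split S B phi1 phi2 : B \subset S ->
  depends_on B phi1 -> depends_on (S :\: B) phi2 ->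
  weighted_sum S (fun f => phi1 f * phi2 f) =
  weighted_sum B phi1 * weighted_sum (S :\: B) phi2.
Proof.
move=> BS d1 d2; rewrite /weighted_sum big_distrlr/= pair_big/=.
pose h (p : {ffun I -> E} * {ffun I -> E}) := [ffun i => if i \in B then p.1 i else p.2 i].
pose h' (f : {ffun I -> E}) : {ffun I -> E} * {ffun I -> E} :=
  ([ffun i => if i \in B then f i else e0],
   [ffun i => if i \in S :\: B then f i else e0]).
rewrite (reindex_onto h h')/=; last first.
  move=> f /supportedP fS; apply/ffunP => i; rewrite !ffunE/= ?ffunE ?inE.
  by case: (boolP (i \in B)) => //= iB; case: (boolP (i \in S)) => // /fS.
apply: eq_big => [[f1 f2]|[f1 f2]] /=.
  apply/idP/idP => [/andP[/supportedP hS /eqP[e1 e2]]|/andP[/supportedP s1 /supportedP s2]].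
    by apply/andP; split; apply/supportedP => i iB; [rewrite -e1|rewrite -e2];
      rewrite ffunE (negbTE iB).
  apply/andP; split.
    apply/supportedP => i iS; rewrite ffunE /=.
    have [/(subsetP BS)|iB] := boolP (i \in B); first by rewrite (negbTE iS).
    by rewrite s2// inE (negbTE iS) andbF.
  apply/eqP; congr pair; apply/ffunP => i; rewrite !ffunE/=.
    by case: (boolP (i \in B)) => // /s1.
  by case: (boolP (i \in S :\: B)) => [|/s2//]; rewrite inE => /andP[/negbTE->].
move=> /andP[/supportedP hS _].
have hB i : i \in B -> h (f1, f2) i = f1 i by rewrite ffunE => ->.
have hSB i : i \in S :\: B -> h (f1, f2) i = f2 i.
  by rewrite ffunE inE => /andP[/negbTE ->].
transitivity (((\prod_(i in B) a i (f1 i)) * (\prod_(i in S :\: B) a i (f2 i))) *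
    (phi1 f1 * phi2 f2)); last by rewrite mulrACA.
rewrite (big_setID B)/= (setIidPr BS); congr (_ * _ * (_ * _)).
- by apply: eq_bigr => i /hB ->.
- by apply: eq_bigr => i /hSB ->.
- by apply: d1 => i /hB.
- by apply: d2 => i /hSB.
Qed.

Lemma weighted_sum_prod S (F : I -> E -> R) :
  \prod_(i in S) \sum_e a i e * F i e =
  weighted_sum S (fun f => \prod_(i in S) F i (f i)).
Proof.
rewrite (big_distr_big e0)/=; apply: eq_big => [f|f _]; last by rewrite big_split.
apply/pffun_onP/supportedP => [[/subsetP s _] i iS|H].
  by apply/eqP; apply: contraNT iS => fi; apply: s.
split; last by move=> x.
by apply/subsetP => i; rewrite inE; apply: contraNT => /H ->.
Qed.

(** Carries a recursion that holds for each labelling over to the weighted sums. Locality of [w] and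
    [M] is what makes the sum of each product factor. *)
Lemma weighted_sum_rec (w M : {ffun I -> E} -> {set I} -> R) S x :
  (forall B, depends_on B (w^~ B)) -> (forall B, depends_on B (M^~ B)) ->
  (forall f, M f S = \sum_(B : {set I} | (B \subset S) && (x \in B))
     w f B * M f (S :\: B)) ->
  weighted_sum S (M^~ S) = \sum_(B : {set I} | (B \subset S) && (x \in B))
     weighted_sum B (w^~ B) * weighted_sum (S :\: B) (M^~ (S :\: B)).
Proof.
move=> dw dM MS; rewrite /weighted_sum.
under eq_bigr do rewrite MS mulr_sumr.
rewrite exchange_big/=; apply: eq_bigr => B /andP[BS _].
by rewrite -weighted_sum_split.
Qed.

Lemma weighted_sumT phi :
  weighted_sum [set: I] phi = \sum_(f : {ffun I -> E}) (\prod_i a i (f i)) * phi f.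
Proof.
apply: eq_big => [f|f _]; first by apply/supportedP => i; rewrite inE.
by congr (_ * _); apply: eq_bigl => i; rewrite inE.
Qed.

End weighted_sums.

Section subset_sums.
Context {T : finType} {R : comNzRingType}.

Lemma sum_subsets_card (D : {set T}) (F : nat -> R) :
  \sum_(C : {set T} | C \subset D) F #|C| =
  \sum_(j < #|D|.+1) 'C(#|D|, j)%:R * F j.
Proof.
have CD (C : {set T}) : C \subset D -> (#|C| < #|D|.+1)%N.
  by move=> CD; rewrite ltnS subset_leq_card.
rewrite (partition_big (fun C : {set T} => inord #|C| : 'I_#|D|.+1) predT)//=.
apply: eq_bigr => j _.
transitivity (\sum_(C in [set C : {set T} | (C \subset D) && (#|C| == j)]) F j).
  apply: eq_big => [C|C /andP[/CD Cn /eqP <-]]; last by rewrite inordK.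
  rewrite inE; case: (boolP (C \subset D)) => //= /CD Cn.
  by rewrite -val_eqE /= inordK.
by rewrite sumr_const cards_draws mulr_natl.
Qed.

End subset_sums.

(* The classical sets library, imported from here on, rebinds many names of
   [finset]. *)
From mathcomp Require Import all_classical all_reals all_analysis.
From mathcomp Require Import measurable_realfun.
From mathcomp.real_closed Require Import complex.
From mathcomp Require Import zify ring lra.

Import numFieldNormedType.Exports.

Local Open Scope classical_set_scope.
Local Open Scope ring_scope.
Local Open Scope complex_scope.

(** * Random variables with moments of all orders *)

Section all_moments.
Context d (T : measurableType d) (R : realType) (P : probability T R).
Implicit Types X Y : T -> R.

(** Unlike integrability, this property is stable under products, so all polynomials in the values
    of [N] can be integrated term by term. *)
Definition all_moments X := measurable_fun [set: T] X /\
  forall p : nat, P.-integrable [set: T] (fun w => (`|X w| ^+ p)%:E).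

Lemma all_moments_measurable X : all_moments X -> measurable_fun [set: T] X.
Proof. by case. Qed.

Lemma all_moments_integrable X : all_moments X ->
  P.-integrable [set: T] (fun w => (X w)%:E).
Proof.
move=> [mX iX]; apply: le_integrable (iX 1%N) => //.
  exact/measurable_EFinP.
by move=> w _; rewrite /= lee_fin expr1 normr_id.
Qed.

Lemma all_moments_le X Y (C : R) : measurable_fun [set: T] X ->
  all_moments Y -> (forall w, `|X w| <= C * `|Y w|) -> all_moments X.
Proof.
move=> mX [mY iY] XY; split=> // p.
have C0 w : 0 <= C * `|Y w| by apply: le_trans (XY w).
apply: (@le_integrable _ _ _ _ _ measurableT _
   (fun w => (C ^+ p)%:E * (`|Y w| ^+ p)%:E)%E); last exact: integrableZl.
  by apply/measurable_EFinP; apply: measurable_funX; exact: measurableT_comp.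
move=> w _; rewrite -EFinM /= lee_fin -exprMn !normrX normr_id (ger0_norm (C0 w)).
by rewrite lerXn2r// nnegrE.
Qed.

Lemma all_moments_cst (r : R) : all_moments (cst r).
Proof. by split=> [//|p]; exact: (@finite_measure_integrable_cst _ _ _ P _ (`|r| ^+
  p)). Qed.

Lemma all_momentsD X Y : all_moments X -> all_moments Y ->
  all_moments (fun w => X w + Y w).
Proof.
move=> [mX iX] [mY iY]; split=> [|p]; first exact: measurable_funD.
apply: (@le_integrable _ _ _ _ _ measurableT _ (fun w => (2 ^+ p)%:E *
   ((`|X w| ^+ p)%:E + (`|Y w| ^+ p)%:E))%E); last first.
- by apply: integrableZl => //; exact: integrableD.
- move=> w _; rewrite -EFinD -EFinM /= lee_fin normrX normr_id.
  rewrite [leRHS]ger0_norm ?mulr_ge0 ?addr_ge0 ?exprn_ge0//.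
  (* Here [a + b <= 2 * b]; the smaller of the two absolute values plays the role of [a]. *)
  have key (a b : R) : 0 <= a -> a <= b -> (a + b) ^+ p <= 2 ^+ p * (a ^+ p + b ^+ p).
    move=> a0 ab; have b0 := le_trans a0 ab.
    apply: (@le_trans _ _ (2 ^+ p * b ^+ p)).
      by rewrite -exprMn lerXn2r// ?nnegrE ?mulr_ge0 ?addr_ge0// mulr_natl mulr2n lerD2r.
    by rewrite ler_pM2l ?exprn_gt0// lerDr exprn_ge0.
  apply: (@le_trans _ _ ((`|X w| + `|Y w|) ^+ p)).
    by rewrite lerXn2r// ?nnegrE ?addr_ge0// ler_normD.
  have [xy|/ltW yx] := leP `|X w| `|Y w|; first exact: key.
  by rewrite addrC [X in _ * X]addrC; exact: key.
- apply/measurable_EFinP; apply: measurable_funX; apply: measurableT_comp => //.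
  exact: measurable_funD.
Qed.

Lemma all_momentsM X Y : all_moments X -> all_moments Y ->
  all_moments (fun w => X w * Y w).
Proof.
move=> [mX iX] [mY iY]; split=> [|p]; first exact: measurable_funM.
apply: (@le_integrable _ _ _ _ _ measurableT _ (fun w =>
   ((`|X w| ^+ (p + p))%:E + (`|Y w| ^+ (p + p))%:E))%E); last first.
- by apply: integrableD.
- move=> w _; rewrite -EFinD /= lee_fin normrX normr_id.
  rewrite [leRHS]ger0_norm ?addr_ge0 ?exprn_ge0//.
  rewrite normrM exprMn !exprD.
  (* With x = |X|^p and y = |Y|^p this is x y <= x^2 + y^2. *)
  have := exprn_ge0 p (normr_ge0 (X w)); have := exprn_ge0 p (normr_ge0 (Y w)).
  move: (_ ^+ p) (_ ^+ p) => x y x0 y0; nra.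
- apply/measurable_EFinP; apply: measurable_funX; apply: measurableT_comp => //.
  exact: measurable_funM.
Qed.

Lemma all_momentsZ (r : R) X : all_moments X -> all_moments (fun w => r * X w).
Proof. by apply: all_momentsM; exact: all_moments_cst. Qed.

Lemma all_momentsN X : all_moments X -> all_moments (fun w => - X w).
Proof. by move=> /(all_momentsZ (- 1)); under eq_fun do rewrite mulN1r. Qed.

Lemma all_moments_sum (I : Type) (s : seq I) (p : pred I) (X : I -> T -> R) :
  (forall i, p i -> all_moments (X i)) ->
  all_moments (fun w => \sum_(i <- s | p i) X i w).
Proof.
move=> H; elim: s => [|i s IH].
  by under eq_fun do rewrite big_nil; exact: all_moments_cst.
under eq_fun do rewrite big_cons; case: (boolP (p i)) => // pi.
by apply: all_momentsD => //; exact: H.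
Qed.

Lemma all_moments_prod (I : Type) (s : seq I) (p : pred I) (X : I -> T -> R) :
  (forall i, p i -> all_moments (X i)) ->
  all_moments (fun w => \prod_(i <- s | p i) X i w).
Proof.
move=> H; elim: s => [|i s IH].
  by under eq_fun do rewrite big_nil; exact: all_moments_cst.
under eq_fun do rewrite big_cons; case: (boolP (p i)) => // pi.
by apply: all_momentsM => //; exact: H.
Qed.

Lemma all_momentsX X n : all_moments X -> all_moments (fun w => X w ^+ n).
Proof.
move=> mX; have -> : (fun w => X w ^+ n) = fun w => \prod_(i < n) X w.
  by apply/funext => w; rewrite prodr_const card_ord.
exact: all_moments_prod.
Qed.

Lemma all_moments_ae X Y : all_moments X -> measurable_fun [set: T] Y ->
  {ae P, forall w, Y w = X w} -> all_moments Y.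
Proof.
move=> [mX iX] mY XY; split=> // p; apply/integrableP; split.
  by apply/measurable_EFinP; apply: measurable_funX; exact: measurableT_comp.
have /integrableP[_] := iX p; congr (_ < _)%E.
apply: ae_eq_integral => //.
- apply: measurableT_comp => //; apply/measurable_EFinP/measurable_funX.
  exact: measurableT_comp.
- apply: measurableT_comp => //; apply/measurable_EFinP/measurable_funX.
  exact: measurableT_comp.
- by apply: filterS XY => w -> _.
Qed.

Lemma Rintegral_probability_cst (r : R) : \int[P]_w r = r.
Proof. by rewrite /Rintegral integral_cst//= probability_setT mule1. Qed.

Lemma Rintegral_ae X Y : measurable_fun [set: T] X ->
  measurable_fun [set: T] Y -> {ae P, forall w, X w = Y w} ->
  \int[P]_w X w = \int[P]_w Y w.
Proof.
move=> mX mY XY; congr fine; apply: ae_eq_integral => //; try exact/measurable_EFinP.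
by apply: filterS XY => w -> _.
Qed.

Lemma Rintegral_fin_sum (I : Type) (s : seq I) (p : pred I) (X : I -> T -> R) :
  (forall i, p i -> all_moments (X i)) ->
  \int[P]_w (\sum_(i <- s | p i) X i w) = \sum_(i <- s | p i) \int[P]_w X i w.
Proof.
move=> H; elim: s => [|i s IH].
  by under eq_Rintegral do rewrite big_nil; rewrite Rintegral_cst// mul0r big_nil.
under eq_Rintegral do rewrite big_cons; rewrite big_cons; case: (boolP (p i)) => // pi.
rewrite RintegralD// ?IH//.
  exact/all_moments_integrable/H.
exact/all_moments_integrable/all_moments_sum.
Qed.

Lemma EFin_Rintegral X : all_moments X ->
  (\int[P]_w X w)%:E = (\int[P]_w (X w)%:E)%E.
Proof.
by move=> /all_moments_integrable iX; rewrite fineK//; exact: integrable_fin_num.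
Qed.

End all_moments.

(** * Joint cumulants from the recursion on moments *)

Section complex_curves.
Context {R : realType}.
Implicit Types (c f g : R -> R[i]) (u v : R[i]).

(** Real and imaginary parts are differentiated separately to match [cpartial]: along a coordinate
    line, a partial derivative is the derivative of such a curve at 0. *)
Definition curve_derive c (t : R) u :=
  is_derive t 1 (fun h => complex.Re (c h)) (complex.Re u) /\
  is_derive t 1 (fun h => complex.Im (c h)) (complex.Im u).

Lemma curve_derive_eq c t u v : curve_derive c t u -> u = v -> curve_derive c t v.
Proof. by move=> ? <-. Qed.

Lemma curve_derive_near f g t u : {near t, f =1 g} ->
  curve_derive f t u -> curve_derive g t u.
Proof.
move=> fg [df1 df2]; split; [apply: near_eq_is_derive df1|apply: near_eq_is_derive df2];
  by near=> h; have -> : f h = g h by near: h; exact: fg.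
Unshelve. all: by end_near. Qed.

Lemma curve_derive_cst v t : curve_derive (cst v) t 0.
Proof. by split; exact: is_derive_cst. Qed.

Lemma curve_deriveD f g t u v : curve_derive f t u -> curve_derive g t v ->
  curve_derive (fun h => f h + g h) t (u + v).
Proof.
move=> [f1 f2] [g1 g2]; split.
  have := is_deriveD f1 g1.
  rewrite (_ : _ + _ = fun h => complex.Re (f h + g h)); last first.
    by apply/funext => h /=; rewrite fctE; case: (f h) (g h) => [? ?] [? ?].
  by move=> H; apply: is_derive_eq H _; case: u v {f1 f2 g1 g2} => [? ?] [? ?].
have := is_deriveD f2 g2.
rewrite (_ : _ + _ = fun h => complex.Im (f h + g h)); last first.
  by apply/funext => h /=; rewrite fctE; case: (f h) (g h) => [? ?] [? ?].
by move=> H; apply: is_derive_eq H _; case: u v {f1 f2 g1 g2} => [? ?] [? ?].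
Qed.

Lemma curve_deriveM f g t u v : curve_derive f t u -> curve_derive g t v ->
  curve_derive (fun h => f h * g h) t (u * g t + f t * v).
Proof.
move=> [f1 f2] [g1 g2]; split.
  have := is_deriveB (is_deriveM f1 g1) (is_deriveM f2 g2).
  rewrite (_ : _ - _ = fun h => complex.Re (f h * g h)); last first.
    by apply/funext => h /=; rewrite !fctE; case: (f h) (g h) => [? ?] [? ?].
  move=> H; apply: is_derive_eq H _; rewrite /GRing.scale/=.
  by case: u v (f t) (g t) {f1 f2 g1 g2} => [? ?] [? ?] [? ?] [? ?] /=; ring.
have := is_deriveD (is_deriveM f1 g2) (is_deriveM f2 g1).
rewrite (_ : _ + _ = fun h => complex.Im (f h * g h)); last first.
  by apply/funext => h /=; rewrite !fctE; case: (f h) (g h) => [? ?] [? ?].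
move=> H; apply: is_derive_eq H _; rewrite /GRing.scale/=.
by case: u v (f t) (g t) {f1 f2 g1 g2} => [? ?] [? ?] [? ?] [? ?] /=; ring.
Qed.

Lemma curve_deriveZ v f t u : curve_derive f t u ->
  curve_derive (fun h => v * f h) t (v * u).
Proof.
move=> df; apply: curve_derive_eq (curve_deriveM (curve_derive_cst v t) df) _.
by rewrite mul0r add0r.
Qed.

Lemma curve_deriveB f g t u v : curve_derive f t u -> curve_derive g t v ->
  curve_derive (fun h => f h - g h) t (u - v).
Proof.
move=> df /(curve_deriveZ (- 1)) dg.
have := curve_deriveD df dg; rewrite mulN1r.
by under eq_fun do rewrite mulN1r.
Qed.

Lemma curve_derive_sum (I : Type) (s : seq I) (p : pred I) (f : I -> R -> R[i])
    (u : I -> R[i]) t :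
  (forall i, p i -> curve_derive (f i) t (u i)) ->
  curve_derive (fun h => \sum_(i <- s | p i) f i h) t (\sum_(i <- s | p i) u i).
Proof.
move=> H; elim: s => [|i s IH].
  by under eq_fun do rewrite big_nil; rewrite big_nil; exact: curve_derive_cst.
under eq_fun do rewrite big_cons; rewrite big_cons; case: (boolP (p i)) => // pi.
by apply: curve_deriveD => //; exact: H.
Qed.

Lemma curve_deriveV f t u : f t != 0 -> curve_derive f t u ->
  curve_derive (fun h => (f h)^-1) t (- u / (f t) ^+ 2).
Proof.
move=> ft0 [f1 f2].
(* The squared modulus: the inverse is the conjugate divided by [q]. *)
pose q h := complex.Re (f h) ^+ 2 + complex.Im (f h) ^+ 2.
have qt0 : q t != 0.
  apply: contra ft0; rewrite /q; case: (f t) => [a b] /=.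
  by rewrite paddr_eq0 ?sqr_ge0// !sqrf_eq0 eq_complex/=.
have dq := is_deriveD (is_deriveX 2 f1) (is_deriveX 2 f2).
have dqV : is_derive t 1 (fun h => (q h)^-1) _ := is_deriveV qt0 dq.
have qtE : q t = complex.Re (f t) ^+ 2 + complex.Im (f t) ^+ 2 by [].
move: (q t) qt0 qtE dqV => qt qt0 qtE dqV.
have uE : - u / f t ^+ 2 =
    ((complex.Re u * complex.Im (f t) ^+ 2 - complex.Re u * complex.Re (f t) ^+ 2
      - complex.Re (f t) * complex.Im (f t) * complex.Im u *+ 2) / qt ^+ 2) +i*
    ((complex.Im u * complex.Im (f t) ^+ 2 - complex.Im u * complex.Re (f t) ^+ 2
      + complex.Re (f t) * complex.Im (f t) * complex.Re u *+ 2) / qt ^+ 2).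
  apply: (mulIf (expf_neq0 2 ft0)); rewrite divfK ?expf_neq0//.
  move: qtE; case: u (f t) {f1 f2 dq dqV ft0} => [x y] [a b] /= qtE.
  rewrite expr2; apply/eqP; rewrite eq_complex /=.
  by apply/andP; split; apply/eqP; rewrite qtE in qt0 *; field.
split.
  have := is_deriveM f1 dqV.
  rewrite (_ : _ * _ = fun h => complex.Re (f h)^-1); last first.
    by apply/funext => h /=; rewrite !fctE /q; case: (f h) => [? ?].
  move=> H; apply: is_derive_eq H _; rewrite /GRing.scale/= uE /= /q.
  by rewrite qtE in qt0 *; field.
have := is_deriveN (is_deriveM f2 dqV).
rewrite (_ : - _ = fun h => complex.Im (f h)^-1); last first.
  by apply/funext => h /=; rewrite !fctE /q; case: (f h) => [? ?].
move=> H; apply: is_derive_eq H _; rewrite /GRing.scale/= uE /= /q.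
by rewrite qtE in qt0 *; field.
Qed.

Lemma curve_derive_Re_gt0 f t u : curve_derive f t u -> 0 < complex.Re (f t) ->
  \forall h \near t, 0 < complex.Re (f h).
Proof.
move=> [f1 _] ft0.
have c1 : {for t, continuous (fun h => complex.Re (f h))}.
  by apply/differentiable_continuous/derivable1_diffP; case: f1.
have := @cvgr_gt R _ (nbhs t) _ (fun h => complex.Re (f h)) _ c1 0 ft0.
exact.
Qed.

(** On the open right half-plane [carg] is the arctangent of Im / Re and the modulus does not
    vanish, so the principal logarithm is smooth there; the curve stays in this half-plane near
    [t]. *)
Lemma curve_derive_clog f t u : 0 < complex.Re (f t) -> curve_derive f t u ->
  curve_derive (fun h => clog (f h)) t (u / f t).
Proof.
move=> ft0 [f1 f2].
pose q h := complex.Re (f h) ^+ 2 + complex.Im (f h) ^+ 2.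
have qt0 : 0 < q t by rewrite ltr_pwDl ?sqr_ge0// exprn_gt0.
have at0 : complex.Re (f t) != 0 by rewrite gt_eqF.
have near_pos := curve_derive_Re_gt0 (conj f1 f2) ft0.
have uE : u / f t =
   ((complex.Re (f t) * complex.Re u + complex.Im (f t) * complex.Im u) / q t) +i*
   ((complex.Re (f t) * complex.Im u - complex.Im (f t) * complex.Re u) / q t).
  have ftn0 : f t != 0 by apply: contra at0 => /eqP ->.
  apply: (mulIf ftn0); rewrite divfK//; rewrite /q in qt0 *.
  case: u (f t) qt0 {f1 f2 at0 ft0 near_pos ftn0} => [x y] [a b] /= qt0.
  apply/eqP; rewrite eq_complex /=.
  by apply/andP; split; apply/eqP; field; rewrite gt_eqF.
have dq : is_derive t 1 q _ := is_deriveD (is_deriveX 2 f1) (is_deriveX 2 f2).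
split.
  apply: (@near_eq_is_derive _ _ _ (2^-1 \*: (@ln R \o q))).
    near=> h.
    have h0 : 0 < complex.Re (f h) by near: h; exact: near_pos.
    rewrite /clog/=.
    have qh : 0 < q h by rewrite ltr_pwDl ?sqr_ge0// exprn_gt0.
    rewrite -{1}[q h]sqr_sqrtr ?(ltW qh)// lnXn ?sqrtr_gt0//.
    rewrite /= /GRing.scale/=.
    by rewrite -[ln _ *+ 2]mulr_natl mulrA mulVf ?mul1r.
  apply: is_derive_eq (is_deriveZ _ (is_derive1_comp (is_derive1_ln qt0) dq)) _.
  rewrite uE /GRing.scale/= /q in qt0 *.
  by field; rewrite gt_eqF.
apply: (@near_eq_is_derive _ _ _ (@atan R \o
    (fun h => complex.Im (f h) * (complex.Re (f h))^-1))).
  near=> h.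
  have h0 : 0 < complex.Re (f h) by near: h; exact: near_pos.
  by rewrite /clog/= /carg; case: (f h) h0 => a b /= ->.
have dV := is_deriveM f2 (is_deriveV at0 f1).
apply: is_derive_eq (is_derive1_comp (is_derive1_atan _) dV) _.
rewrite uE /GRing.scale/= /q in qt0 *.
rewrite [X in 1 + X ^+ 2](_ : _ = complex.Im (f t) * (complex.Re (f t))^-1)//.
move: (complex.Re (f t)) (complex.Im (f t)) at0 qt0 => a b a0 q0.
by field; rewrite a0 (gt_eqF q0).
Unshelve. all: by end_near. Qed.

End complex_curves.

(** * Differentiation under the expectation *)

Section char_derivatives.
Context d (T : measurableType d) (R : realType) (P : probability T R).

(** Dominated differentiation: as [c'] is bounded by 1, [|Y w * X w|] dominates the derivative for
    every [h]. It is meant for cosine and sine in place of [c]. *)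
Lemma is_derive_Rintegral_bounded (c c' : R -> R) (Y X a : T -> R) :
  (forall x : R, is_derive x 1 c (c' x)) ->
  (forall x, `|c x| <= 1) -> (forall x, `|c' x| <= 1) ->
  all_moments P Y -> all_moments P X -> measurable_fun [set: T] a ->
  is_derive (0 : R) 1 (fun h => \int[P]_w (Y w * c (a w + h * X w)))
    (\int[P]_w (Y w * X w * c' (a w))).
Proof.
move=> dc c1 c'1 mY mX ma.
have mc : measurable_fun [set: R] c.
  apply: continuous_measurable_fun => x.
  by apply/differentiable_continuous/derivable1_diffP; case: (dc x).
pose I : set R := `](-1), 1[%classic.
pose f (h : R) w := Y w * c (a w + h * X w).
have df (h : R) w : is_derive h 1 (f ^~ w) (Y w * (X w * c' (a w + h * X w))).
  have d1 : is_derive h 1 (fun h : R => a w + h * X w) (X w).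
    have := is_deriveD (is_derive_cst (a w) h 1) (is_deriveM (is_derive_id h 1)
      (is_derive_cst (X w) h 1)).
    by move=> H; apply: is_derive_eq H _; rewrite /GRing.scale/= mulr0 !add0r mulr1.
  have := is_deriveZ (Y w) (is_derive1_comp (dc _) d1).
  by move=> H; apply: is_derive_eq H _; rewrite /GRing.scale/= [X in _ * X]mulrC.
have intf (h : R) : I h -> P.-integrable [set: T] (EFin \o f h).
  move=> _; apply: all_moments_integrable; apply: (@all_moments_le _ _ _ _ _ Y 1) => //.
    apply: measurable_funM; first by case: mY.
    apply: measurableT_comp => //; apply: measurable_funD => //.
    by apply: measurable_funM => //; case: mX.
  by move=> w; rewrite normrM mul1r ler_piMr.
have derf (h : R) w : I h -> [set: T] w -> derivable (f ^~ w) h 1.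
  by move=> _ _; case: (df h w).
have pE (h : R) w : partial1of2 f h w = Y w * (X w * c' (a w + h * X w)).
  by rewrite partial1of2E; case: (df h w).
have iG : P.-integrable [set: T] (EFin \o (fun w => `|Y w * X w|)).
  apply: all_moments_integrable; apply: (@all_moments_le _ _ _ _ _ (fun w => Y w * X w) 1).
  - apply: measurableT_comp => //.
    by apply: measurable_funM; [case: mY|case: mX].
  - exact: all_momentsM.
  - by move=> w; rewrite mul1r normr_id.
have G1 (h : R) w : I h -> [set: T] w -> `|partial1of2 f h w| <= `|Y w * X w|.
  by move=> _ _; rewrite pE mulrA normrM ler_piMr.
have I0 : I (0 : R) by rewrite /I /= in_itv/= ltrN10 ltr01.
have H1 := @derivable_under_integral _ _ _ P f setT measurableT 0 (-1) 1 I0 intf derf _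
  (fun w => normr_ge0 _) iG G1.
have H2 := @differentiation_under_integral _ _ _ P f setT measurableT 0 (-1) 1 I0 intf
  derf _
  (fun w => normr_ge0 _) iG G1.
apply: DeriveDef; first exact: H1.
rewrite -derive1E H2; apply: eq_Rintegral => w _.
by rewrite pE mul0r addr0 mulrA.
Qed.

End char_derivatives.

Section line_derivatives.
Context (R : realType) (k : nat).

Lemma derive_line (f : 'rV[R]_k -> R) z v u :
  is_derive (0 : R) 1 (fun h => f (h *: v + z)) u -> 'D_v f z = u.
Proof.
case=> _ <-; rewrite /derive.
rewrite [X in lim (X @ _)](_ : _ =
  (fun h => h^-1 *: (((fun h => f (h *: v + z)) \o shift 0) (h *: 1) - f (0 *: v + z))))//.
apply/funext => h /=; rewrite addr0 scale0r add0r.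
by rewrite /GRing.scale/= mulr1.
Qed.

Lemma cpartialE l (g : 'rV[R]_k -> R[i]) z u :
  curve_derive (fun h => g (h *: delta_mx 0 l + z)) 0 u -> cpartial l g z = u.
Proof.
move=> [d1 d2]; rewrite /cpartial (derive_line (f := fun z => complex.Re (g z)) d1).
by rewrite (derive_line (f := fun z => complex.Im (g z)) d2); case: u {d1 d2}.
Qed.

End line_derivatives.

(** * Derivatives of the logarithm of the characteristic function *)

Section cumulant_recursion.
Context d (T : measurableType d) (R : realType) (P : probability T R).
Context (k : nat) (X : 'I_k -> T -> R).
Hypothesis mX : forall j, all_moments P (X j).
Implicit Types (S B : {set 'I_k}) (z : 'rV[R]_k) (l : 'I_k).

Let XS S w := \prod_(j in S) X j w.
Let phase z w := \sum_(l < k) z 0 l * X l w.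

(** The expectation of the product of the [X j], [j] in [S], times exp (i <z, X>). Multiplied by
    ['i ^+ #|S|], it is the derivative of the characteristic function along the coordinates of
    [S]. *)
Definition weighted_char_fun S z : R[i] :=
  (\int[P]_w (XS S w * cos (phase z w))) +i*
  (\int[P]_w (XS S w * sin (phase z w))).
Local Notation F := weighted_char_fun.

Let mXS S : all_moments P (XS S).
Proof. by apply: all_moments_prod => j _; exact: mX. Qed.

Let mphase z : measurable_fun [set: T] (phase z).
Proof.
apply: (all_moments_measurable (P := P)); apply: all_moments_sum => l _.
exact: all_momentsZ.
Qed.

Let phaseD l (h : R) z w :
  phase (h *: delta_mx 0 l + z) w = phase z w + h * X l w.
Proof.
rewrite /phase (eq_bigr (fun i => z 0 i * X i w + h * (if i == l then X i w else 0))).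
  by rewrite big_split/= -mulr_sumr -big_mkcond/= big_pred1_eq.
move=> i _; rewrite !mxE eqxx/= mulrDl addrC -mulrA; congr (_ + _ * _).
by case: eqP => _; rewrite (mul1r, mul0r).
Qed.

Let XS1 l S w : l \notin S -> XS S w * X l w = XS (l |: S)%SET w.
Proof. by move=> lS; rewrite /XS big_setU1//= mulrC. Qed.

(** Taking [l] outside [S] keeps every variable at power at most one, so the derivative has the same
    form again. *)
Lemma weighted_char_fun_derive l S z : l \notin S ->
  curve_derive (fun h => F S (h *: delta_mx 0 l + z)) 0 ('i * F (l |: S)%SET z).
Proof.
move=> lS.
split => /=.
- under eq_fun do under eq_Rintegral do rewrite phaseD.
  have := is_derive_Rintegral_bounded (@is_derive_cos R) (@cos_max R) _ (mXS S) (mX l)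
    (mphase z).
  have H x : `|- sin x| <= 1 :> R by rewrite normrN sin_max.
  move=> /(_ H) H'; apply: is_derive_eq H' _.
  rewrite mul0r mul1r sub0r -[RHS]mulN1r -RintegralZl//; last first.
    apply: all_moments_integrable; apply: (all_moments_le (C := 1) (Y := XS (l |:
      S)%SET)) => //.
      apply: measurable_funM; first by case: (mXS (l |: S)%SET).
      apply: measurableT_comp => //; apply: continuous_measurable_fun;
        exact: continuous_sin.
    by move=> w; rewrite normrM mul1r ler_piMr// sin_max.
  by apply: eq_Rintegral => w _; rewrite XS1// mulN1r mulrN.
- under eq_fun do under eq_Rintegral do rewrite phaseD.
  have := is_derive_Rintegral_bounded (@is_derive_sin R) (@sin_max R) (@cos_max R) (mXS
    S) (mX l) (mphase z).
  move=> H'; apply: is_derive_eq H' _.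
  rewrite mul0r mul1r add0r.
  by apply: eq_Rintegral => w _; rewrite XS1.
Qed.

Context (j0 : 'I_k).

(* For [j0] in [S], [cumulant_ratio S] is the iterated derivative of the
   logarithm of the characteristic function along the coordinates of [S],
   divided by ['i ^+ #|S|]. *)
Fixpoint cumulant_ratio_rec n S z : R[i] :=
  if n is m.+1 then
    (F S z - \sum_(B : {set 'I_k} | (B \proper S) && (j0 \in B))
       cumulant_ratio_rec m B z * F (S :\: B)%SET z) / F finset.set0 z
  else 0.

(** The cardinal is enough fuel, since each call goes to a proper subset. *)
Definition cumulant_ratio S := cumulant_ratio_rec #|S| S.
Local Notation G := cumulant_ratio.

(** The relation [F S = \sum_B G B * F (S :\: B)], solved for its term [B = S]. *)
Lemma cumulant_ratioE S z : j0 \in S ->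
  G S z = (F S z - \sum_(B : {set 'I_k} | (B \proper S) && (j0 \in B))
       G B z * F (S :\: B)%SET z) / F finset.set0 z.
Proof.
have pos B : j0 \in B -> (0 < #|B|)%N by move=> ?; apply/card_gt0P; exists j0.
have H' n m B : (#|B| <= n)%N -> (#|B| <= m)%N -> j0 \in B ->
    cumulant_ratio_rec n B z = cumulant_ratio_rec m B z.
  elim: n m B => [|n IH] [|m] B // Bn Bm j0B; try by have := pos B j0B; lia.
  rewrite /=; congr ((_ - _) / _); apply: eq_bigr => A /andP[AB j0A].
  by congr (_ * _); have ABc := proper_card AB; apply: IH => //; lia.
have H n B : (#|B| <= n)%N -> j0 \in B -> cumulant_ratio_rec n B z = G B z.
  by move=> Bn j0B; exact: H'.
move=> j0S; rewrite {1}/G -(prednK (pos S j0S)) /=.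
congr ((_ - _) / _); apply: eq_bigr => A /andP[AB j0A].
by congr (_ * _); apply: H => //; rewrite -ltnS (prednK (pos S j0S)) proper_card.
Qed.

(** Differentiating the formula for [S] gives the one for [l |: S]: a proper subset [B] of [S]
    yields [l |: B] when [G B] is differentiated, and [B] itself when [F (S :\: B)] is. *)
Lemma cumulant_ratio_derive S l z : j0 \in S -> l \notin S ->
  F finset.set0 z != 0 ->
  curve_derive (fun h => G S (h *: delta_mx 0 l + z)) 0 ('i * G (l |: S)%SET z).
Proof.
move=> j0S + Fz0; have [n] := ubnP #|S|; elim: n S j0S => // n IH S j0S Sn lS.
under eq_fun do rewrite cumulant_ratioE//.
have l0 : l \notin (finset.set0 : {set 'I_k}) by rewrite inE.
have F0 : F finset.set0 (0 *: delta_mx 0 l + z) != 0 by rewrite scale0r add0r.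
have dV := curve_deriveV (f := fun h => F finset.set0 (h *: delta_mx 0 l + z)) F0
  (weighted_char_fun_derive z l0).
have dS : curve_derive (fun h => \sum_(B : {set 'I_k} | (B \proper S) && (j0 \in B))
    G B (h *: delta_mx 0 l + z) * F (S :\: B)%SET (h *: delta_mx 0 l + z)) 0
    (\sum_(B : {set 'I_k} | (B \proper S) && (j0 \in B))
      ('i * G (l |: B)%SET z * F (S :\: B)%SET (0 *: delta_mx 0 l + z) +
       G B (0 *: delta_mx 0 l + z) * ('i * F (l |: (S :\: B))%SET z))).
  apply: curve_derive_sum => B /andP[BS j0B].
  apply: curve_deriveM.
    apply: IH => //; first by apply: leq_trans (proper_card BS) _; rewrite -ltnS.
    by apply: contra lS; exact: (fintype.subsetP (proper_sub BS)).
  by apply: weighted_char_fun_derive; rewrite inE (negbTE lS) andbF.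
have := curve_deriveM (curve_deriveB (weighted_char_fun_derive z lS) dS) dV.
move=> H; apply: curve_derive_eq H _.
rewrite scale0r !add0r cumulant_ratioE ?inE ?j0S ?orbT//.
rewrite finset.setU0.
rewrite [in RHS](bigID (fun B : {set 'I_k} => l \in B))/=.
rewrite [X in _ = 'i * ((_ - (X + _)) / _)](_ : _ =
    \sum_(B : {set 'I_k} | (B \proper S) && (j0 \in B)) G (l |: B)%SET z * F (S :\:
      B)%SET z); last first.
  rewrite (reindex_onto (fun B => l |: B)%SET (fun B => B :\ l)%SET) /=; last first.
    by move=> B /andP[_ lB]; exact: finset.setD1K.
  have j0l : j0 != l by apply: contraNneq lS => <-.
  apply: eq_big => [B|B /andP[/andP[/andP[_ _] _] /eqP BE]].
    rewrite !inE eqxx (negbTE j0l)/= andbT.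
    have [lB|lB] := boolP (l \in B).
      rewrite (_ : ((l |: B) :\ l == B)%SET = false) ?andbF//; last first.
        by apply/negbTE/eqP => /finset.setP/(_ l); rewrite !inE eqxx lB.
      apply/esym/negbTE; rewrite negb_and; apply/orP; left.
      by apply: contra lS => /proper_sub/fintype.subsetP/(_ _ lB).
    rewrite finset.setU1K// eqxx andbT; congr (_ && _).
    by rewrite !properEcard !cardsU1 lB lS ltn_add2l finset.subUset finset.sub1set !inE
      eqxx/=; congr (_ && _);
      apply/idP/idP => [/fintype.subsetP H|/fintype.subset_trans];
        [apply/fintype.subsetP => x xB;
        have := H x xB; rewrite !inE => /orP[/eqP xl|//]; rewrite -xl xB in lB|apply;
          exact: finset.subsetUr].
  congr (_ * F _ _); apply/finset.setP => x; rewrite !inE.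
  by case: eqP => //= ->; rewrite (negbTE lS) andbF.
(* Among the subsets avoiding [l] there is also [S] itself, which is proper in [l |: S]; its term
   comes from the derivative of [1 / F set0]. *)
rewrite [X in _ = 'i * ((_ - (_ + X)) / _)](_ : _ =
    G S z * F [set l]%SET z +
    \sum_(B : {set 'I_k} | (B \proper S) && (j0 \in B)) G B z * F (l |: (S :\: B))%SET
      z); last first.
  rewrite (bigD1 S)/=; last first.
    by rewrite j0S lS !andbT properEcard finset.subsetUr cardsU1 lS add1n leqnn.
  congr (_ * F _ _ + _).
    apply/finset.setP => x; rewrite !inE; have [xS|xS] := boolP (x \in S); rewrite ?orbF//=.
    by apply/esym/eqP => xl; rewrite -xl xS in lS.
  apply: eq_big => [B|B /andP[/andP[_ lB] _]]; last first.
    congr (_ * F _ _); apply/finset.setP => x; rewrite !inE.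
    by case: eqP => //= ->; rewrite lB.
  apply/idP/idP => [/andP[/andP[/andP[BlS ->] lB] BS]|/andP[BS ->]].
    rewrite andbT finset.properEneq BS; apply/fintype.subsetP => x xB.
    have := fintype.subsetP (proper_sub BlS) x xB; rewrite !inE => /orP[/eqP xl|//].
    by rewrite -xl xB in lB.
  have lB : l \notin B by apply: contra lS; exact: (fintype.subsetP (proper_sub BS)).
  rewrite lB (proper_neq BS) !andbT; apply: fintype.proper_sub_trans BS _.
  exact: finset.subsetUr.
rewrite (cumulant_ratioE z j0S).
under eq_bigr do rewrite -mulrA [X in _ + X]mulrCA -mulrDr.
rewrite -mulr_sumr big_split/=.
move: (F S z) (F (l |: S)%SET z) (F [set l]%SET z) (F finset.set0 z) Fz0 => a b c e e0.
set s := \sum_(i | _) G i z * F (S :\: i)%SET z.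
by field.
Qed.

Lemma joint_char_funE z : joint_char_fun P X z = F finset.set0 z.
Proof.
rewrite /joint_char_fun unlock /F /Rintegral; congr (fine _ +i* fine _);
  by apply: eq_integral => w _; rewrite /XS big_set0 mul1r.
Qed.

Lemma weighted_char_fun0 S : F S 0 = (\int[P]_w (\prod_(j in S) X j w))%:C.
Proof.
have ph w : phase 0 w = 0 by rewrite /phase big1// => l _; rewrite mxE mul0r.
congr (_ +i* _).
  by apply: eq_Rintegral => w _; rewrite ph cos0 mulr1.
under eq_Rintegral do rewrite ph sin0 mulr0.
by rewrite Rintegral_cst// mul0r.
Qed.

(** The point [z] is general because the next derivative needs the formula on a neighbourhood. The
    first derivative, along [j0], turns the logarithm into ['i * F [set j0] / F set0]; all later
    index sets contain [j0]. *)
Lemma mixed_partial_cumulant s z : uniq s -> j0 \notin s ->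
  0 < complex.Re (F finset.set0 z) ->
  foldr (@cpartial R k) (cpartial j0 (fun z => clog (joint_char_fun P X z))) s z =
  'i ^+ (size s).+1 * G (j0 |: [set x in s])%SET z.
Proof.
elim: s z => [|l s IH] z /=.
  move=> _ _ z0; apply: cpartialE.
  under eq_fun do rewrite joint_char_funE.
  have l0 : j0 \notin (finset.set0 : {set 'I_k}) by rewrite inE.
  have z0' : 0 < complex.Re (F finset.set0 (0 *: delta_mx 0 j0 + z)) by rewrite scale0r
    add0r.
  have := curve_derive_clog z0' (weighted_char_fun_derive z l0).
  move=> H; apply: curve_derive_eq H _.
  rewrite scale0r add0r expr1 cumulant_ratioE ?inE ?eqxx//.
  rewrite big_pred0 ?subr0 ?mulrA => [|B].
    by congr ('i * F _ _ / _); apply/finset.setP => x; rewrite !inE ?orbF.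
  apply/negbTE/negP => /andP[BS jB]; have := proper_card BS.
  have -> : (j0 |: [set x in [::]] = [set j0])%SET.
    by apply/finset.setP => x; rewrite !inE orbF.
  by rewrite cards1 ltnS leqn0 cards_eq0 => /eqP B0; rewrite B0 inE in jB.
move=> /andP[ls us]; rewrite inE negb_or => /andP[jl js] z0.
apply: cpartialE.
have l0 : l \notin (finset.set0 : {set 'I_k}) by rewrite inE.
have z0' : 0 < complex.Re (F finset.set0 (0 *: delta_mx 0 l + z)) by rewrite scale0r add0r.
(* The real part stays positive near [z], so the induction hypothesis applies along the line. *)
have nz := curve_derive_Re_gt0 (weighted_char_fun_derive z l0) z0'.
apply: (@curve_derive_near _ (fun h =>
    'i ^+ (size s).+1 * G (j0 |: [set x in s])%SET (h *: delta_mx 0 l + z))).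
  by near=> h; rewrite IH//; near: h; exact: nz.
have Fn0 : F finset.set0 z != 0.
  apply/eqP => F0; move: z0.
  by rewrite -[X in 0 < X]/(complex.Re (F finset.set0 z)) F0 ltxx.
have lS : l \notin (j0 |: [set x in s])%SET.
  by rewrite !inE negb_or ls andbT eq_sym.
have jS : j0 \in (j0 |: [set x in s])%SET by rewrite !inE eqxx.
have := curve_deriveZ ('i ^+ (size s).+1) (cumulant_ratio_derive jS lS Fn0).
move=> H; apply: curve_derive_eq H _.
rewrite mulrA -exprSr; congr (_ * G _ _).
by apply/finset.setP => x; rewrite !inE orbCA.
Unshelve. all: by end_near. Qed.

(** At 0 the functions [F] are the moments and [F set0] is 1, so [G] and [K] obey the same
    recursion. *)
Lemma cumulant_ratio0 (K : {set 'I_k} -> R) :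
  (forall S, j0 \in S -> \int[P]_w (\prod_(j in S) X j w) =
    \sum_(B : {set 'I_k} | (B \subset S) && (j0 \in B))
      K B * \int[P]_w (\prod_(j in S :\: B) X j w)) ->
  forall S, j0 \in S -> G S 0 = (K S)%:C.
Proof.
move=> KE S; have [n] := ubnP #|S|; elim: n S => // n IH S Sn j0S.
have M0 : \int[P]_w (\prod_(j in (finset.set0 : {set 'I_k})) X j w) = 1.
  under eq_Rintegral do rewrite big_set0.
  exact: Rintegral_probability_cst.
rewrite cumulant_ratioE// !weighted_char_fun0 M0 divr1 KE// (bigD1 S)/=; last first.
  by rewrite fintype.subxx.
rewrite finset.setDv M0 mulr1 rmorphD/= rmorph_sum/=.
rewrite -addrA [X in _ + X](_ : _ = 0) ?addr0//; apply/eqP; rewrite subr_eq0; apply/eqP.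
apply: eq_big => [B|B /andP[/andP[BS j0B] BnS]].
  by rewrite finset.properEneq; case: (B == S); case: (B \subset S); case: (j0 \in B).
have BS' : B \proper S by rewrite finset.properEneq BnS.
rewrite weighted_char_fun0 IH ?rmorphM//.
by apply: leq_trans (proper_card BS') _; rewrite -ltnS.
Qed.

End cumulant_recursion.

Lemma joint_cumulant_recursion d (T : measurableType d) (R : realType)
    (P : probability T R) (k : nat) (X : 'I_k -> T -> R) (K : {set 'I_k} -> R) :
  (0 < k)%N -> (forall j, all_moments P (X j)) ->
  (forall (S : {set 'I_k}) j0, j0 \in S -> \int[P]_w (\prod_(j in S) X j w) =
    \sum_(B : {set 'I_k} | (B \subset S) && (j0 \in B))
      K B * \int[P]_w (\prod_(j in S :\: B) X j w)) ->
  joint_cumulant P X = (K [set: 'I_k]%SET)%:C.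
Proof.
move=> k0 mX KE; rewrite /joint_cumulant /mixed_partial.
have := enum_uniq 'I_k; have := size_enum_ord k; have := mem_enum 'I_k.
(* [foldr] differentiates along the last index of the enumeration first; that index becomes [j0]. *)
case/lastP: (enum 'I_k) => [|s j0] memE sizeE; first by rewrite -sizeE in k0.
rewrite rcons_uniq => /andP[j0s us]; rewrite size_rcons in sizeE.
rewrite foldr_rcons mixed_partial_cumulant//; last first.
  rewrite weighted_char_fun0//=; under eq_Rintegral do rewrite big_set0.
  by rewrite Rintegral_probability_cst.
(* [(- 'i) ^+ k * 'i ^+ k = 1]. *)
rewrite sizeE mulrA -exprMn mulNr -expr2 sqr_i opprK expr1n mul1r.
rewrite (_ : (_ |: _)%SET = [set: 'I_k]%SET); last first.
  by apply/finset.setP => x; rewrite !inE; have := memE x; rewrite mem_rcons !inE.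
by apply: cumulant_ratio0 => //; [move=> S; exact: KE|rewrite inE].
Qed.

(** * Moments of a compensated Poisson measure *)

Section poisson_moments.
Context {R : realType} (r : R).
Hypothesis r_ge0 : 0 <= r.
Local Notation Po := (poisson_prob r 0%N).

Lemma ge0_integral_poisson (g : nat -> R) : 0 < r -> (forall k, 0 <= g k) ->
  (\int[Po]_k (g k)%:E = \sum_(k <oo) (g k * poisson_pmf r k)%:E)%E.
Proof.
move=> r0 g0.
have -> : [set: nat] = \bigcup_k [set k] by apply/seteqP; split => // k _; exists k.
rewrite ge0_integral_bigcup//.
- apply: eq_eseriesr => k _.
  rewrite (eq_integral (cst (g k)%:E)); last by move=> x; rewrite inE /= => ->.
  rewrite integral_cst//= /poisson_prob r0 esum_set1 ?EFinM//.
  by rewrite lee_fin poisson_pmf_ge0.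
- by move=> k _; rewrite lee_fin.
- by apply/trivIsetP => i j _ _ ij; apply/seteqP; split => // x [/= -> ji];
  rewrite ji eqxx in ij.
Qed.

(** The Poisson weights satisfy k p(k) = r p(k - 1): the term k = 0 vanishes and the series is
    shifted. *)
Lemma poisson_stein (g : nat -> R) : (forall k, 0 <= g k) ->
  (\int[Po]_k (k%:R * g k)%:E = r%:E * \int[Po]_k (g k.+1)%:E)%E.
Proof.
move=> g0; have [r0|] := ltP 0 r; last first.
  (* At parameter 0 [poisson_prob] is the Dirac mass at 0 and both sides vanish. *)
  move=> r0; have r00 : r = 0 by apply/eqP; rewrite eq_le r0.
  rewrite r00 mul0e (@eq_measure_integral _ _ _ _ \d_0%N).
    by rewrite integral_dirac// diracT mul0r mul1e.
  by move=> A mA _; rewrite /= /poisson_prob ifF//; apply/negbTE; rewrite -leNgt.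
rewrite (ge0_integral_poisson (g := fun k => k%:R * g k))// => [|k];
  last by rewrite mulr_ge0.
rewrite (ge0_integral_poisson (g := fun k => g k.+1))//.
have pmf0 k := poisson_pmf_ge0 r k.
rewrite -nneseriesZl; last by move=> k _; rewrite lee_fin mulr_ge0.
rewrite nneseries_recl//; last by move=> k _; rewrite lee_fin !mulr_ge0.
rewrite !mul0r add0e -nneseries_addn; last by move=> k; rewrite lee_fin !mulr_ge0.
apply: eq_eseriesr => k _; rewrite addn1 -EFinM; congr EFin.
rewrite /poisson_pmf r0 exprS factS natrM.
by field; rewrite pnatr_eq0 -lt0n fact_gt0/=.
Qed.

(** By [poisson_stein] the moment of order [p.+1] is r E (k + 1)^p, which the moment of order [p]
    controls. *)
Lemma poisson_all_moments : all_moments Po (fun k => k%:R).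
Proof.
split=> // p; apply/integrableP; split => //.
suff: (\int[Po]_k (k%:R ^+ p)%:E < +oo)%E.
  by apply: le_lt_trans; rewrite le_eqVlt; apply/orP; left; apply/eqP;
    apply: eq_integral => k _;
    rewrite gee0_abs ?lee_fin ?exprn_ge0// normr_nat.
elim: p => [|p IH].
  under eq_integral do rewrite expr0; rewrite integral_cst// mul1e.
  by apply: le_lt_trans (ltry 1); exact: probability_le1.
under eq_integral do rewrite exprS.
rewrite poisson_stein; last by move=> k; rewrite exprn_ge0.
apply: lte_mul_pinfty => //.
(* For k >= 1 one has (k + 1)^p <= (2 k)^p; the constant [2 ^+ p] takes care of k = 0. *)
apply: (@le_lt_trans _ _ (\int[Po]_k ((2 ^+ p * k%:R ^+ p)%:E + (2 ^+ p)%:E))%E).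
  apply: ge0_le_integral => //.
  move=> [|k] _; rewrite -EFinD lee_fin.
    by rewrite expr1n ler_wpDl ?mulr_ge0 ?exprn_ge0// exprn_ege1// ler1n.
  rewrite -exprMn ler_wpDr ?exprn_ge0// lerXn2r ?nnegrE ?mulr_ge0// -natrM ler_nat; lia.
rewrite ge0_integralD//.
- under eq_integral do rewrite EFinM.
  rewrite ge0_integralZl//.
  + rewrite lte_add_pinfty//; first by apply: lte_mul_pinfty.
    rewrite integral_cst//; apply: lte_mul_pinfty => //.
    by apply: le_lt_trans (ltry 1); exact: probability_le1.
Qed.

Lemma poisson_stein_signed (g : nat -> R) :
  all_moments Po g -> all_moments Po (fun k => g k.+1) ->
  \int[Po]_k (k%:R * g k) = r * \int[Po]_k g k.+1.
Proof.
move=> mg mgS.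
pose gp k := Num.max (g k) 0; pose gn k := Num.max (- g k) 0.
have gE k : g k = gp k - gn k by rewrite /gp /gn; case: (leP (g k) 0);
  case: (leP (- g k) 0); lra.
have mle h h' : all_moments Po h -> (forall k : nat, `|h' k| <= `|h k|) -> all_moments
  Po h'.
  by move=> mh hh; apply: (all_moments_le (C := 1)) mh _ => // k; rewrite mul1r.
have gp_le k : `|gp k| <= `|g k| by rewrite /gp; case: (leP (g k) 0) => // _;
  rewrite normr0.
have gn_le k : `|gn k| <= `|g k|.
  by rewrite /gn; case: (leP (- g k) 0) => // _; rewrite ?normr0 ?normrN.
have mgp := mle _ _ mg gp_le; have mgn := mle _ _ mg gn_le.
have mgpS := mle _ (fun k => gp k.+1) mgS (fun k => gp_le k.+1).
have mgnS := mle _ (fun k => gn k.+1) mgS (fun k => gn_le k.+1).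
have st h : all_moments Po (fun k => h k.+1) -> (forall k, 0 <= h k) ->
    \int[Po]_k (k%:R * h k) = r * \int[Po]_k h k.+1.
  move=> mh h0; rewrite /Rintegral poisson_stein// fineM//.
  exact/integrable_fin_num/all_moments_integrable.
under eq_Rintegral do rewrite gE mulrBr.
under [in RHS]eq_Rintegral do rewrite gE.
rewrite !RintegralB ?mulrBr ?st//; try exact: all_moments_integrable.
- by move=> k; rewrite /gn le_max lexx orbT.
- by move=> k; rewrite /gp le_max lexx orbT.
- by apply: all_moments_integrable; apply: all_momentsM mgp; exact: poisson_all_moments.
- by apply: all_moments_integrable; apply: all_momentsM mgn; exact: poisson_all_moments.
Qed.

Lemma centered_poisson_all_moments : all_moments Po (fun k => k%:R - r).
Proof. by apply: all_momentsD; [exact: poisson_all_moments|exact: all_moments_cst]. Qed.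

(** E (K - r)^(p+1) = E K (K - r)^p - r E (K - r)^p = r E ((K + 1 - r)^p - (K - r)^p). In the
    binomial expansion the term of degree p cancels, hence [j < p]: centring is what removes the
    blocks of one element. *)
Lemma centered_poisson_moment_rec p :
  \int[Po]_k ((k%:R - r) ^+ p.+1) =
  r * \sum_(j < p) 'C(p, j)%:R * \int[Po]_k ((k%:R - r) ^+ j).
Proof.
have mX q := all_momentsX q centered_poisson_all_moments.
have mS : all_moments Po (fun k => (k.+1%:R - r) ^+ p).
  apply: all_momentsX; have -> : (fun k => k.+1%:R - r) = fun k : nat => k%:R - r + 1.
    by apply/funext => k; rewrite -natr1; ring.
  by apply: all_momentsD; [exact: centered_poisson_all_moments|exact: all_moments_cst].
under eq_Rintegral do rewrite exprS mulrBl.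
rewrite RintegralB//; last 2 first.
- by apply: all_moments_integrable; apply: all_momentsM (mX p); exact: poisson_all_moments.
- by apply: all_moments_integrable; exact: all_momentsZ.
rewrite RintegralZl//; last exact: all_moments_integrable.
rewrite (poisson_stein_signed (g := fun k => (k%:R - r) ^+ p))// -mulrBr; congr (_ * _).
transitivity (\int[Po]_k (\sum_(j < p.+1) 'C(p, j)%:R * (k%:R - r) ^+ j) -
    \int[Po]_k ((k%:R - r) ^+ p)).
  congr (_ - _); apply: eq_Rintegral => k _.
  have -> : k.+1%:R - r = 1 + (k%:R - r) by rewrite -natr1; ring.
  rewrite exprDn; apply: eq_bigr => j _.
  by rewrite expr1n mul1r mulr_natl.
rewrite Rintegral_fin_sum; last by move=> j _; exact: all_momentsZ.
rewrite big_ord_recr/= binn.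
under [X in _ + X - _]eq_Rintegral do rewrite mul1r.
rewrite addrK; apply: eq_bigr => j _.
by rewrite RintegralZl//; exact: all_moments_integrable.
Qed.

End poisson_moments.

(** * Product moments of independent discrete variables *)

Section independence.
Context d (T : measurableType d) (R : realType) (P : probability T R).

Lemma integral_discrete_split (X : {RV P >-> R}) (v : nat -> R)
    (h : R -> R) (H : T -> R) :
  injective v -> {ae P, forall w, exists n, X w = v n} ->
  measurable_fun [set: R] h -> (forall x, 0 <= h x) ->
  measurable_fun [set: T] H -> (forall w, 0 <= H w) ->
  (\int[P]_w (h (X w) * H w)%:E =
   \sum_(n <oo) (h (v n))%:E * \int[P]_w (\1_[set v n] (X w) * H w)%:E)%E.
Proof.
move=> vI Xv mh h0 mH H0.
have mX : measurable_fun [set: T] X by [].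
have mI n : measurable_fun [set: T] (fun w => \1_[set v n] (X w) * H w).
  apply: measurable_funM => //.
  have mv : measurable_fun [set: R] (\1_[set v n] : R -> R).
    by apply: measurable_indic; exact: measurable_set1.
  exact: (measurableT_comp mv mX).
have f0 n w : (0 <= (h (v n) * (\1_[set v n] (X w) * H w))%:E)%E.
  by rewrite lee_fin !mulr_ge0.
transitivity (\int[P]_w \sum_(n <oo) (h (v n) * (\1_[set v n] (X w) * H w))%:E)%E.
  apply: ge0_ae_eq_integral => //.
  - apply/measurable_EFinP; apply: measurable_funM => //.
    exact: measurableT_comp.
  - apply: ge0_emeasurable_sum => //= n _; apply/measurable_EFinP.
    by apply: measurable_funM.
  - by move=> w _; rewrite lee_fin mulr_ge0.
  - by move=> w _; apply: nneseries_ge0.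
  - apply: filterS Xv => w [n Xn] _ /=.
    rewrite (@nneseriesD1 R _ n xpredT)// eseries0 ?adde0.
      by rewrite Xn indicE mem_set// mul1r.
    move=> k _ /= kn; rewrite Xn indicE memNset ?mul0r ?mulr0//= => /vI nk.
    by rewrite nk eqxx in kn.
rewrite integral_nneseries//; last first.
  by move=> n; apply/measurable_EFinP; exact: measurable_funM.
apply: eq_eseriesr => n _; under eq_integral do rewrite EFinM.
rewrite ge0_integralZl//; first exact/measurable_EFinP.
  by move=> w _; rewrite lee_fin mulr_ge0.
by rewrite lee_fin.
Qed.

Context (m : nat) (X : 'I_m -> {RV P >-> R}) (v : 'I_m -> nat -> R).
Hypothesis indX : independent_RVs X.
Hypothesis vI : forall i, injective (v i).
Hypothesis Xv : forall i, {ae P, forall w, exists n, X i w = v i n}.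

(* Induction on the set [S] of indices whose factor is not yet an indicator; the
   discreteness of [X i] turns a factor into a series of indicators. *)
Lemma ge0_integral_independent_prod (S : {set 'I_m}) (g : 'I_m -> R -> R) :
  (forall i, measurable_fun [set: R] (g i)) -> (forall i x, 0 <= g i x) ->
  (forall i, \int[P]_w (g i (X i w))%:E < +oo)%E ->
  (forall i, i \notin S -> exists2 A, measurable A & g i = \1_A) ->
  (\int[P]_w (\prod_i g i (X i w))%:E = \prod_i \int[P]_w (g i (X i w))%:E)%E.
Proof.
have [n] := ubnP #|S|; elim: n S g => // n IH S g Sn mg g0 gfin gS.
have [S0|[i0 i0S]] := set_0Vmem S.
  have /choice[A gA] : forall i, exists A, measurable A /\ g i = \1_A.
    by move=> i; have [|A mA gE] := gS i; [rewrite S0 inE|exists A].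
  transitivity (P (\bigcap_(i in [set: 'I_m]) (X i @^-1` A i))).
    rewrite -[X in P X]setIT -integral_indic//.
      apply: eq_integral => w _; congr EFin; rewrite indicE.
      have [wA|wA] := pselect ((\bigcap_(i in [set: 'I_m]) (X i @^-1` A i)) w).
        rewrite mem_set// big1// => i _; rewrite (gA i).2 indicE mem_set//.
        exact: wA.
      rewrite memNset//.
      have /existsNP[i /not_implyP[_ nA]] := wA.
      by rewrite (bigD1 i)//= (gA i).2 indicE memNset// mul0r.
    apply: fin_bigcap_measurable => // i _.
    by rewrite -[X in measurable X]setTI; apply: measurable_funP => //; exact: (gA i).1.
  rewrite indX; last by move=> i; case: (gA i).
  apply: eq_bigr => i _; rewrite (gA i).2 -[X in P X]setIT -integral_indic//.
  by rewrite -[X in measurable X]setTI; apply: measurable_funP => //; exact: (gA i).1.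
have mX i : measurable_fun [set: T] (X i) by [].
pose H w := \prod_(i | i != i0) g i (X i w).
have mH : measurable_fun [set: T] H.
  rewrite /H; under eq_fun do rewrite big_mkcond/=.
  apply: measurable_prod => i _; case: (i != i0) => //.
  exact: (measurableT_comp (mg i) (mX i)).
have H0 w : 0 <= H w by apply: prodr_ge0.
under eq_integral do rewrite (bigD1 i0)//=.
rewrite (integral_discrete_split (vI (i := i0)) (Xv i0) (mg i0) (g0 i0) mH H0).
rewrite (bigD1 i0)//=.
set c := (\prod_(i | _) _)%E.
have cfin : c \is a fin_num.
  rewrite /c; elim/big_ind : _ => // [x y|i _]; first exact: fin_numM.
  by rewrite ge0_fin_numE// integral_ge0// => w _; rewrite lee_fin.
transitivity (\sum_(k <oo) c * ((g i0 (v i0 k))%:E * \int[P]_w (\1_[set v i0 k] (X i0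
  w) * 1)%:E))%E.
  apply: eq_eseriesr => k _.
  (* The factor [i0] becomes the indicator of one of its values, which removes [i0] from [S]. *)
  pose g' i := if i == i0 then \1_[set v i0 k] : R -> R else g i.
  rewrite muleCA; congr (_ * _)%E.
  have mk : measurable_fun [set: R] (\1_[set v i0 k] : R -> R).
    by apply: measurable_indic; exact: measurable_set1.
  have E1 : (\int[P]_w (g' i0 (X i0 w))%:E = \int[P]_w (\1_[set v i0 k] (X i0 w) * 1)%:E)%E.
    by apply: eq_integral => w _; rewrite /g' eqxx mulr1.
  have E2 i : i != i0 -> g' i = g i by rewrite /g' => /negbTE ->.
  have key : (\int[P]_w (\prod_i g' i (X i w))%:E = \prod_i \int[P]_w (g' i (X i w))%:E)%E.
    apply: (IH (S :\ i0)%SET).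
    - by rewrite -ltnS; apply: leq_trans Sn; rewrite [in leqRHS](cardsD1 i0) i0S.
    - by move=> i; rewrite /g'; case: ifP.
    - by move=> i x; rewrite /g'; case: ifP.
    - move=> i; rewrite /g'; case: (i == i0) => //.
      apply: (@le_lt_trans _ _ (\int[P]_w 1%:E)%E).
        apply: ge0_le_integral => //.
        + by apply/measurable_EFinP; exact: (measurableT_comp mk (mX i)).
        + by move=> w _; rewrite lee_fin indicE; case: (_ \in _).
      by rewrite integral_cst//= probability_setT mule1 ltry.
    - move=> i; rewrite !inE negb_and negbK /g'; case: (i == i0) => [_|/= iS].
        by exists [set v i0 k] => //; exact: measurable_set1.
      exact: gS.
  rewrite (bigD1 i0)//= E1 in key.
  rewrite (eq_bigr (fun i => \int[P]_w (g i (X i w))%:E)%E) in key; last first.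
    by move=> i ii0; rewrite E2.
  rewrite -/c muleC in key; rewrite -key.
  apply: eq_integral => w _; rewrite (bigD1 i0)//= /g' eqxx; congr (_ * _)%:E.
  by apply: eq_bigr => i ii0; rewrite (negbTE ii0).
rewrite -(fineK cfin) nneseriesZl; last first.
  move=> k _; rewrite mule_ge0 ?lee_fin//; apply: integral_ge0 => w _.
  by rewrite lee_fin mulr_ge0.
rewrite muleC; congr (_ * _)%E.
(* The same series with [H = 1], read backwards. *)
rewrite -(integral_discrete_split (vI (i := i0)) (Xv i0) (mg i0) (g0 i0))//.
by apply: eq_integral => w _; rewrite mulr1.
Qed.

(** Each [h i] is the signed sum of its positive and negative parts. The product expands over sign
    vectors [s], and the nonnegative case applies to each term. *)
Lemma Rintegral_independent_prod (h : 'I_m -> R -> R) :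
  (forall i, measurable_fun [set: R] (h i)) ->
  (forall i, all_moments P (fun w => h i (X i w))) ->
  \int[P]_w (\prod_i h i (X i w)) = \prod_i \int[P]_w h i (X i w).
Proof.
move=> mh hX.
pose sg (b : bool) : R := if b then 1 else -1.
pose g (b : bool) i x := Num.max (sg b * h i x) 0.
have hE i x : h i x = \sum_(b : bool) sg b * g b i x.
  rewrite big_bool /sg /g !mul1r !mulN1r.
  by case: (leP (h i x) 0); case: (leP (- h i x) 0); rewrite /=; lra.
have g0 b i x : 0 <= g b i x by rewrite /g le_max lexx orbT.
have mg b i : measurable_fun [set: R] (g b i).
  by apply: measurable_maxr => //; exact: measurable_funM.
have gX b i : all_moments P (fun w => g b i (X i w)).
  apply: (all_moments_le (C := 1)) (hX i) _.
    exact: (measurableT_comp (mg b i)).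
  move=> w; rewrite mul1r /g; case: (leP (sg b * h i (X i w)) 0) => _;
    first by rewrite normr0.
  by rewrite /sg; case: b; rewrite ?mul1r// mulN1r normrN.
have gprod (s : {ffun 'I_m -> bool}) : \int[P]_w (\prod_i g (s i) i (X i w)) =
    \prod_i \int[P]_w g (s i) i (X i w).
  apply: EFin_inj; rewrite EFin_Rintegral; last exact: all_moments_prod.
  rewrite (ge0_integral_independent_prod (S := [set: 'I_m]%SET) (g := fun i =>
    g (s i) i))//.
  - rewrite (big_morph EFin EFinM erefl); apply: eq_bigr => i _.
    by rewrite EFin_Rintegral.
  - by move=> i; rewrite -EFin_Rintegral// ltry.
  - by move=> i; rewrite inE.
transitivity (\int[P]_w \sum_(s : {ffun 'I_m -> bool})
    (\prod_i sg (s i)) * \prod_i g (s i) i (X i w)).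
  apply: eq_Rintegral => w _.
  rewrite (eq_bigr (fun i => \sum_(b : bool) sg b * g b i (X i w))); last by move=> i _;
    exact: hE.
  by rewrite bigA_distr_bigA; apply: eq_bigr => s _; rewrite big_split.
rewrite Rintegral_fin_sum; last first.
  by move=> s _; apply: all_momentsZ; exact: all_moments_prod.
rewrite (eq_bigr (fun s : {ffun 'I_m -> bool} => \prod_i (sg (s i) * \int[P]_w g (s i)
  i (X i w)))).
  rewrite -(bigA_distr_bigA (fun i b => sg b * \int[P]_w g b i (X i w))).
  apply: eq_bigr => i _; rewrite (@eq_Rintegral _ _ _ P _ (fun w =>
    \sum_(b : bool) sg b * g b i (X i w))).
    rewrite Rintegral_fin_sum; last by move=> b _; exact: all_momentsZ.
    by apply: eq_bigr => b _; rewrite RintegralZl//; exact: all_moments_integrable.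
  by move=> w _; exact: hE.
move=> s _; rewrite RintegralZl//; last first.
  by apply: all_moments_integrable; apply: all_moments_prod.
by rewrite gprod big_split.
Qed.

End independence.

(** * Integrals of linear combinations of indicators *)

Section simple_integrals.
Context d (T : measurableType d) (R : realType) (mu : {measure set T -> \bar R}).

Lemma Rintegral_sum_indic (I : Type) (s : seq I) (a : I -> R) (A : I -> set T) :
  (forall i, measurable (A i)) -> (forall i, mu (A i) < +oo)%E ->
  \int[mu]_x (\sum_(i <- s) a i * \1_(A i) x) = \sum_(i <- s) a i * fine (mu (A i)).
Proof.
move=> mA Afin.
have iA i : mu.-integrable [set: T] (fun x => (\1_(A i) x)%:E).
  apply/integrableP; split; first exact/measurable_EFinP/measurable_indic.
  under eq_integral do rewrite gee0_abs ?lee_fin//.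
  by rewrite integral_indic// setIT.
have iaA i : mu.-integrable [set: T] (fun x => (a i * \1_(A i) x)%:E).
  by under eq_fun do rewrite EFinM; exact: integrableZl.
elim: s => [|i s IH].
  under eq_Rintegral do rewrite big_nil.
  by rewrite big_nil /Rintegral integral0.
under eq_Rintegral do rewrite big_cons.
rewrite RintegralD//; last first.
  rewrite (_ : _ \o _ = fun x => (\sum_(j <- s) (a j * \1_(A j) x)%:E)%E).
    exact: integrable_sum.
  by apply/funext => x; rewrite sumEFin.
  exact: iaA.
rewrite big_cons IH; congr (_ + _).
rewrite (RintegralZl _ measurableT (iA i)); congr (_ * _).
by rewrite /Rintegral integral_indic// setIT.
Qed.

Lemma fine_measure_linear (I : finType) (a : I -> R) (A : I -> set T) (B : set T) :
  measurable B -> (forall i, measurable (A i)) -> (forall i, mu (A i) < +oo)%E ->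
  (forall x, \1_B x = \sum_i a i * \1_(A i) x) ->
  fine (mu B) = \sum_i a i * fine (mu (A i)).
Proof.
move=> mB mA Afin BE; rewrite -Rintegral_sum_indic//.
under [in RHS]eq_Rintegral do rewrite -BE.
by rewrite /Rintegral integral_indic// setIT.
Qed.

End simple_integrals.

(** * Joint moments of the values of a compensated Poisson measure *)

Section compensated_poisson_moments.
Context dO (Omega : measurableType dO) (R : realType) (P : probability Omega R).
Context dZ (Z : measurableType dZ) (nu : {measure set Z -> \bar R}).
Context (N : set Z -> {RV P >-> R}).
Hypothesis N_poisson : compensated_poisson_measure nu N.

Section law.
Context (B : set Z).
Hypothesis B_fin : finite_sets nu B.
Let r := fine (nu B).
Let phi (k : nat) : R := k%:R - r.

Let r_ge0 : 0 <= r. Proof. exact: fine_ge0. Qed.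

Let mphi : measurable_fun [set: nat] phi. Proof. by []. Qed.

Lemma compensated_poisson_ge0_integral (g : R -> \bar R) :
  measurable_fun [set: R] g -> (forall x, 0 <= g x)%E ->
  (\int[P]_w g (N B w) = \int[poisson_prob r 0%N]_k g (phi k))%E.
Proof.
move=> mg g0; rewrite -(ge0_integral_distribution (N B))//.
rewrite (@eq_measure_integral _ _ _ _ (pushforward (poisson_prob r 0%N) phi)).
  by rewrite ge0_integral_pushforward.
by move=> A mA _; exact: (compensated_poisson_law N_poisson B_fin).
Qed.

Lemma compensated_poisson_all_moments : all_moments P (N B).
Proof.
split=> // p.
have mg : measurable_fun [set: R] (fun x : R => (`|x| ^+ p)%:E).
  by apply/measurable_EFinP; apply: measurable_funX; exact: normr_measurable.
apply/integrableP; split.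
  exact: (measurableT_comp mg).
under eq_integral do rewrite gee0_abs ?lee_fin ?exprn_ge0//.
rewrite (compensated_poisson_ge0_integral (g := fun x : R => (`|x| ^+ p)%:E))//.
have [_ /(_ p)/integrableP[_]] := centered_poisson_all_moments r_ge0.
apply: le_lt_trans; rewrite le_eqVlt; apply/orP; left; apply/eqP.
by apply: eq_integral => k _; rewrite gee0_abs// lee_fin exprn_ge0.
Qed.

Lemma compensated_poisson_moment p :
  \int[P]_w (N B w ^+ p) = \int[poisson_prob r 0%N]_k (phi k ^+ p).
Proof.
have mg : measurable_fun [set: R] (fun x : R => (x ^+ p)%:E).
  by apply/measurable_EFinP; exact: measurable_funX.
rewrite /Rintegral -(integral_distribution mg); last first.
  exact/all_moments_integrable/all_momentsX/compensated_poisson_all_moments.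
rewrite (@eq_measure_integral _ _ _ _ (pushforward (poisson_prob r 0%N) phi)).
  rewrite integral_pushforward//.
  exact/all_moments_integrable/all_momentsX/centered_poisson_all_moments.
by move=> A mA _; exact: (compensated_poisson_law N_poisson B_fin).
Qed.

Lemma compensated_poisson_moment_rec p : \int[P]_w (N B w ^+ p.+1) =
  r * \sum_(j < p) 'C(p, j)%:R * \int[P]_w (N B w ^+ j).
Proof.
rewrite compensated_poisson_moment centered_poisson_moment_rec//.
by congr (_ * _); apply: eq_bigr => j _; rewrite compensated_poisson_moment.
Qed.

(** The law charges only the range of [phi], which is countable. This supplies the discreteness
    assumed in the product formula for independent variables. *)
Lemma compensated_poisson_discrete :
  {ae P, forall w, exists n : nat, N B w = n%:R - r}.
Proof.
have mr : measurable (range phi).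
  have -> : range phi = \bigcup_n [set phi n].
    by apply/seteqP; split => x [n _ /=]; [move=> <-; exists n|move=> ->; exists n].
  by apply: bigcup_measurable => n _; exact: measurable_set1.
exists (N B @^-1` (~` range phi)); split.
- by rewrite -[X in measurable X]setTI; apply: measurable_funP => //; exact: measurableC.
- have := compensated_poisson_law N_poisson B_fin (measurableC mr).
  rewrite /distribution /pushforward => ->.
  by rewrite (_ : _ @^-1` _ = set0) ?measure0//; apply/seteqP; split => // k /= [];
    exists k.
- by move=> w /= nw [k _ kw]; apply: nw; exists k.
Qed.

End law.

Section disjoint_family.
Context {E : finType} (A : E -> set Z).
Hypothesis A_fin : forall e, finite_sets nu (A e).
Hypothesis A_triv : trivIset [set: E] A.

Lemma compensated_poisson_disjoint_prod (p : E -> nat) :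
  \int[P]_w (\prod_e N (A e) w ^+ p e) = \prod_e \int[P]_w (N (A e) w ^+ p e).
Proof.
have eb := @enum_val_bij E.
pose X (i : 'I_#|E|) := N (A (enum_val i)).
have iX : independent_RVs X.
  apply: (compensated_poisson_independent N_poisson (B := fun i : 'I_#|E| =>
    A (enum_val i))) => //.
  move=> i j _ _ ij; exact/enum_val_inj/A_triv.
rewrite (reindex _ (onW_bij _ eb))/=.
under eq_Rintegral do rewrite (reindex _ (onW_bij _ eb))/=.
pose v (i : 'I_#|E|) (n : nat) : R := n%:R - fine (nu (A (enum_val i))).
have vI i : injective (v i) by move=> n n' /addIr /(mulrIn (oner_neq0 R)).
have Xv i : {ae P, forall w, exists n, X i w = v i n}.
  exact: compensated_poisson_discrete.
apply: (@Rintegral_independent_prod _ _ _ _ _ X v iX vI Xv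
  (fun i (x : R) => x ^+ p (enum_val i))).
- by move=> i; exact: measurable_funX.
- by move=> i; apply: all_momentsX; exact: compensated_poisson_all_moments.
Qed.

Context {I : finType} (c : I -> E).

(** The joint cumulant of the [N (D i)], [i] in [B]: all cumulants of a Poisson law equal its
    parameter, and centring kills the first one. *)
Definition intersection_weight (D : I -> set Z) (B : {set I}) : R :=
  if (2 <= #|B|)%N then fine (nu (\bigcap_(i in [set` B]) D i)) else 0.

(** By independence the moment is a product over [E] of moments of single values. A [B] that mixes
    different sets has empty intersection; on the [B] made of copies of [A (c x)] the claim is
    [compensated_poisson_moment_rec], with subsets counted by cardinal. *)
Lemma disjoint_family_moment_rec (S : {set I}) x : x \in S ->
  \int[P]_w (\prod_(i in S) N (A (c i)) w) =
  \sum_(B : {set I} | (B \subset S) && (x \in B))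
    intersection_weight (A \o c) B *
    \int[P]_w (\prod_(i in S :\: B) N (A (c i)) w).
Proof.
move=> xS.
pose mu e p := \int[P]_w (N (A e) w ^+ p).
pose d (U : {set I}) e := #|[set i in U | c i == e]%SET|.
have ME (U : {set I}) : \int[P]_w (\prod_(i in U) N (A (c i)) w) = \prod_e mu e (d U e).
  rewrite -compensated_poisson_disjoint_prod; apply: eq_Rintegral => w _.
  rewrite (partition_big c predT)//=; apply: eq_bigr => e _.
  rewrite (eq_bigr (fun=> N (A e) w)); last by move=> i /andP[_ /eqP ->].
  rewrite prodr_const; congr (_ ^+ _); rewrite /d.
  by apply: eq_card => i; rewrite !inE.
set a0 := c x; pose S1 := [set i in S | c i == a0]%SET.
pose r := fine (nu (A a0)).
pose Q := \prod_(e | e != a0) mu e (d S e).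
have xS1 : x \in S1 by rewrite inE xS eqxx.
have S1S : S1 \subset S by apply/fintype.subsetP => i; rewrite inE => /andP[].
have [p pE] : exists p, #|S1| = p.+1.
  by exists #|S1|.-1; rewrite prednK//; apply/card_gt0P; exists x.
have w0 (B : {set I}) : B \subset S -> x \in B -> ~~ (B \subset S1) ->
    intersection_weight (A \o c) B = 0.
  move=> BS xB /subsetPn[y yB yS1]; rewrite /intersection_weight; case: ifP => // _.
  rewrite (_ : \bigcap_(i in _) _ = set0) ?measure0//; apply/seteqP; split => // z H.
  have zx : A (c x) z by apply: H.
  have zy : A (c y) z by apply: H.
  have cyx : c y = c x := A_triv Logic.I Logic.I (ex_intro _ z (conj zy zx)).
  by move: yS1; rewrite inE (fintype.subsetP BS y yB) /a0 -cyx eqxx.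
have w1 (B : {set I}) : B \subset S1 -> x \in B ->
    intersection_weight (A \o c) B = if (2 <= #|B|)%N then r else 0.
  move=> BS1 xB; rewrite /intersection_weight; case: ifP => // _; congr (fine (nu _)).
  apply/seteqP; split => z; first by apply.
  move=> za i /= iB; have := fintype.subsetP BS1 i iB.
  by rewrite inE => /andP[_ /eqP ->].
have MB (B : {set I}) : B \subset S1 ->
   \prod_e mu e (d (S :\: B)%SET e) = mu a0 #|(S1 :\: B)%SET| * Q.
  move=> BS1; rewrite (bigD1 a0)//=; congr (mu _ _ * _).
    by apply: eq_card => i; rewrite !inE andbA.
  apply: eq_bigr => e ea0; congr (mu _ _).
  apply: eq_card => i; rewrite !inE; case: (boolP (i \in B)) => //= iB.
  have := fintype.subsetP BS1 i iB; rewrite inE => /andP[-> /eqP ->].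
  by rewrite eq_sym (negbTE ea0).
have -> : \int[P]_w (\prod_(i in S) N (A (c i)) w) = mu a0 p.+1 * Q.
  by rewrite ME -(finset.setD0 S) MB ?finset.sub0set// finset.setD0 pE.
have -> : mu a0 p.+1 = r * \sum_(j < p) 'C(p, j)%:R * mu a0 j.
  exact: (compensated_poisson_moment_rec (A_fin a0)).
rewrite (bigID (fun B : {set I} => B \subset S1))/= [X in _ = _ + X]big1 ?addr0; last first.
  by move=> B /andP[/andP[BS xB] BS1]; rewrite w0// mul0r.
(* [C] stands for [S1 :\: B]: there are ['C(p, j)] of them of size [j], and [#|C| < p] says that [B]
   has at least two elements. *)
transitivity (\sum_(C : {set I} | C \subset S1 :\ x)
   (if (#|C| < p)%N then r * mu a0 #|C| else 0) * Q).
  rewrite -mulr_suml; congr (_ * _).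
  rewrite (sum_subsets_card (S1 :\ x)%SET (fun k => if (k < p)%N then r * mu a0 k else 0)).
  have -> : #|(S1 :\ x)%SET| = p.
    by have := cardsD1 x S1; rewrite xS1 pE => -[].
  rewrite big_ord_recr/= ltnn mulr0 addr0 mulr_sumr; apply: eq_bigr => j _.
  by rewrite ltn_ord mulrCA.
have DDK (C : {set I}) : C \subset S1 -> (S1 :\: (S1 :\: C) = C)%SET.
  by move=> CS1; rewrite finset.setDDr finset.setDv finset.set0U; apply/finset.setIidPr.
rewrite (reindex_onto (fun B : {set I} => S1 :\: B)%SET (fun C => S1 :\: C)%SET)/=;
  last first.
  by move=> C CS1x; apply: DDK; apply: fintype.subset_trans CS1x _; exact: subD1set.
have predE (B : {set I}) : (S1 :\: B \subset S1 :\ x)%SET && (S1 :\: (S1 :\: B) == B)%SET =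
    (B \subset S) && (x \in B) && (B \subset S1).
  apply/idP/idP => [/andP[sub /eqP BE]|/andP[/andP[BS xB] BS1]].
    have BS1 : B \subset S1 by rewrite -BE finset.subsetDl.
    rewrite BS1 (fintype.subset_trans BS1 S1S)/= andbT.
    apply/negPn/negP => xB; have := fintype.subsetP sub x.
    by rewrite !inE xB xS !eqxx => /(_ isT).
  rewrite DDK// eqxx andbT; apply/fintype.subsetP => i; rewrite !inE => /andP[iB ->].
  by rewrite andbT; apply: contraNneq iB => ->.
apply: eq_big => [//|B]; rewrite predE => /andP[/andP[BS xB] BS1].
rewrite ME MB// w1//.
have := cardsD S1 B; rewrite (finset.setIidPr BS1) pE => cD.
have B0 : (0 < #|B|)%N by apply/card_gt0P; exists x.
have Bp : (#|B| <= p.+1)%N by rewrite -pE; exact: subset_leq_card.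
rewrite (_ : (#|(S1 :\: B)%SET| < p)%N = (1 < #|B|)%N); last by rewrite cD; lia.
by case: ifP => _; rewrite ?mul0r ?mulrA.
Qed.

End disjoint_family.

Lemma compensated_poisson_linear (E : finType) (a : E -> R) (A : E -> set Z) B :
  finite_sets nu B -> (forall e, finite_sets nu (A e)) ->
  (forall z, \1_B z = \sum_e a e * \1_(A e) z) ->
  {ae P, forall w, N B w = \sum_e a e * N (A e) w}.
Proof.
move=> Bfin Afin BE.
(* [Y] is orthogonal to every [N C], hence to itself. *)
pose Y w := N B w - \sum_e a e * N (A e) w.
have mN C : finite_sets nu C -> all_moments P (N C).
  exact: compensated_poisson_all_moments.
have mS : all_moments P (fun w => \sum_e a e * N (A e) w).
  by apply: all_moments_sum => e _; apply: all_momentsZ; exact: mN.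
have mY : all_moments P Y by apply: all_momentsD; [exact: mN|exact: all_momentsN].
have cov C D : finite_sets nu C -> finite_sets nu D ->
    \int[P]_w (N C w * N D w) = fine (nu (C `&` D)).
  move=> Cf Df; rewrite -(compensated_poisson_covariance N_poisson Cf Df).
  by rewrite unlock.
have YN C : finite_sets nu C -> \int[P]_w (Y w * N C w) = 0.
  move=> Cfin.
  have -> : \int[P]_w (Y w * N C w) =
      \int[P]_w (N B w * N C w) - \int[P]_w (\sum_e a e * (N (A e) w * N C w)).
    rewrite -RintegralB//.
    - by apply: eq_Rintegral => w _; rewrite /Y mulrBl mulr_suml;
        congr (_ - _); apply: eq_bigr => e _; rewrite mulrA.
    - by apply: all_moments_integrable; apply: all_momentsM; exact: mN.
    - apply: all_moments_integrable; apply: all_moments_sum => e _.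
      by apply: all_momentsZ; apply: all_momentsM; exact: mN.
  rewrite Rintegral_fin_sum; last first.
    by move=> e _; apply: all_momentsZ; apply: all_momentsM; exact: mN.
  rewrite cov// (fine_measure_linear (a := a) (A := fun e => A e `&` C)); first last.
  - move=> z; rewrite indicI /= BE mulr_suml; apply: eq_bigr => e _.
    by rewrite indicI /= mulrA.
  - move=> e; apply: le_lt_trans (Afin e).2; apply: le_measure; rewrite ?inE;
    [|exact: (Afin e).1|exact: subIsetl].
    by apply: measurableI; [exact: (Afin e).1|exact: Cfin.1].
  - by move=> e; apply: measurableI; [exact: (Afin e).1|exact: Cfin.1].
  - by apply: measurableI; [exact: Bfin.1|exact: Cfin.1].
  apply/eqP; rewrite subr_eq0; apply/eqP; apply: eq_bigr => e _.
  rewrite RintegralZl ?cov//.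
  by apply: all_moments_integrable; apply: all_momentsM; exact: mN.
have Y2 : \int[P]_w (Y w ^+ 2) = 0.
  transitivity (\int[P]_w (Y w * N B w) - \int[P]_w (\sum_e a e * (Y w * N (A e) w))).
    rewrite -RintegralB//.
    - apply: eq_Rintegral => w _; rewrite expr2 {2}/Y mulrBr; congr (_ - _).
      by rewrite mulr_sumr; apply: eq_bigr => e _; rewrite mulrCA.
    - by apply: all_moments_integrable; apply: all_momentsM => //; exact: mN.
    - apply: all_moments_integrable; apply: all_moments_sum => e _.
      by apply: all_momentsZ; apply: all_momentsM => //; exact: mN.
  rewrite YN// Rintegral_fin_sum; last first.
    by move=> e _; apply: all_momentsZ; apply: all_momentsM => //; exact: mN.
  rewrite big1 ?subr0// => e _; rewrite RintegralZl ?YN ?mulr0//.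
  by apply: all_moments_integrable; apply: all_momentsM => //; exact: mN.
have : (\int[P]_w `|(Y w ^+ 2)%:E| = 0)%E.
  under eq_integral do rewrite gee0_abs ?lee_fin ?sqr_ge0//.
  by rewrite -EFin_Rintegral ?Y2//; exact: all_momentsX.
have mY2 : measurable_fun [set: Omega] (fun w => (Y w ^+ 2)%:E).
  by apply/measurable_EFinP/measurable_funX; case: mY.
move=> /(ae_eq_integral_abs _ measurableT mY2); apply: filterS => w /(_ Logic.I) /= [].
by move=> /eqP; rewrite sqrf_eq0 subr_eq0 => /eqP.
Qed.

Section general_sets.
Context {I : finType} (D : I -> set Z).
Hypothesis D_fin : forall i, finite_sets nu (D i).
Implicit Types (S B U : {set I}) (f : {ffun I -> {set I}}).

(* The complement of the union of the [D i] is left out: its measure may be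
   infinite. *)
Definition atom U := [set z | U != finset.set0 /\ forall i, D i z <-> i \in U].

Lemma atom_finite_sets U : finite_sets nu (atom U).
Proof.
have [->|[i iU]] := set_0Vmem U.
  rewrite (_ : atom _ = set0); last by apply/seteqP; split => // z [/eqP].
  by split; [exact: measurable0|rewrite measure0].
have U0 : U != finset.set0 by apply/set0Pn; exists i.
have mU : measurable (atom U).
  rewrite (_ : atom U = \bigcap_(j in [set: I]) (if j \in U then D j else ~` D j)).
    apply: fin_bigcap_measurable => [|j _]; first exact: finite_finset.
    have [mj _] := D_fin j.
    by case: ifP => // _; exact: measurableC.
  apply/seteqP; split => z.
    by move=> [_ H] j _; case: ifPn => [/H//|/negP jU /H].
  move=> H; split => // j; have := H j Logic.I; case: ifPn => // jU Hj.
split=> //; apply: le_lt_trans (D_fin i).2; apply: le_measure; rewrite ?inE//.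
  exact: (D_fin i).1.
by move=> z [_ /(_ i) H]; apply/H.
Qed.

Lemma atom_trivIset : trivIset [set: {set I}] atom.
Proof.
move=> U V _ _ [z [[_ HU] [_ HV]]]; apply/finset.setP => i.
by apply/idP/idP => [/HU/HV|/HV/HU].
Qed.

(** A point of the intersection lies in exactly one atom, that of its trace [U0]; [x \in B] makes
    the trace nonempty, as [atom] requires. *)
Lemma indic_intersection_atoms B x z : x \in B ->
  \1_(\bigcap_(i in [set` B]) D i) z = \sum_(U : {set I}) (B \subset U)%:R * \1_(atom
    U) z :> R.
Proof.
move=> xB; pose U0 : {set I} := [set i | `[< D i z >]]%SET.
have U0P i : (i \in U0) <-> D i z by rewrite inE; split => [/asboolP|/asboolP].
rewrite indicE; have [zB|zB] := pselect ((\bigcap_(i in [set` B]) D i) z).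
  have BU0 : B \subset U0 by apply/fintype.subsetP => i /zB /U0P.
  rewrite mem_set// (bigD1 U0)//= BU0 mul1r indicE mem_set; last first.
    split=> [|i]; first by apply/set0Pn; exists x; exact: (fintype.subsetP BU0).
    by split => /U0P.
  rewrite big1 ?addr0// => U UU0; rewrite indicE memNset ?mulr0// => -[_ H].
  by case/eqP: UU0; apply/finset.setP => i; apply/idP/idP => [/H/U0P|/U0P/H].
rewrite memNset// big1// => U _; have [BU|] := boolP (B \subset U); last by rewrite mul0r.
rewrite indicE memNset ?mulr0// => -[_ H]; apply: zB => i iB.
by apply/H/(fintype.subsetP BU).
Qed.

Lemma compensated_poisson_moment_rec_sets S x : x \in S ->
  \int[P]_w (\prod_(i in S) N (D i) w) =
  \sum_(B : {set I} | (B \subset S) && (x \in B))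
    intersection_weight D B * \int[P]_w (\prod_(i in S :\: B) N (D i) w).
Proof.
move=> xS; pose a (i : I) (U : {set I}) : R := (i \in U)%:R.
have mN C : finite_sets nu C -> all_moments P (N C).
  exact: compensated_poisson_all_moments.
have mA (U : {set I}) : all_moments P (N (atom U)) by apply: mN; exact: atom_finite_sets.
have ND i : {ae P, forall w, N (D i) w = \sum_(U : {set I}) a i U * N (atom U) w}.
  apply: compensated_poisson_linear => //; first by move=> U; exact: atom_finite_sets.
  move=> z; rewrite -[D i](_ : \bigcap_(j in [set` [set i]%SET]) D j = _).
    rewrite (indic_intersection_atoms _ (set11 i)).
    by apply: eq_bigr => U _; rewrite finset.sub1set.
  apply/seteqP; split => [t|t Dt j /=]; first by apply; rewrite /= set11.
  by rewrite inE => /eqP ->.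
have ME S' : \int[P]_w (\prod_(i in S') N (D i) w) =
    weighted_sum finset.set0 a S'
      (fun f => \int[P]_w (\prod_(i in S') N (atom (f i)) w)).
  transitivity (\int[P]_w (weighted_sum finset.set0 a S'
      (fun f => \prod_(i in S') N (atom (f i)) w))).
    apply: Rintegral_ae.
    - by apply: (@all_moments_measurable _ _ _ P); apply: all_moments_prod => i _;
      exact: mN.
    - apply: (@all_moments_measurable _ _ _ P); apply: all_moments_sum => f _.
      by apply: all_momentsZ; apply: all_moments_prod => i _; exact: mA.
    - have : {ae P, forall w i, N (D i) w = \sum_(U : {set I}) a i U * N (atom U) w}.
        exact: filter_forall.
      apply: filterS => w H; rewrite -(weighted_sum_prod _ a S' (fun i U => N (atom U) w)).
      by apply: eq_bigr => i _; exact: H.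
  rewrite Rintegral_fin_sum; last first.
    by move=> f _; apply: all_momentsZ; apply: all_moments_prod => i _; exact: mA.
  apply: eq_bigr => f _; rewrite RintegralZl//.
  by apply: all_moments_integrable; apply: all_moments_prod => i _; exact: mA.
(* For each choice [f] of atoms the recursion of the disjoint case applies. *)
rewrite ME (@weighted_sum_rec _ _ _ _ _ (fun f => intersection_weight (atom \o f))
  (fun f U => \int[P]_w (\prod_(i in U) N (atom (f i)) w)) _ x); first last.
- by move=> f; apply: disjoint_family_moment_rec => //;
  [exact: atom_finite_sets|exact: atom_trivIset].
- by move=> B f g fg; apply: eq_Rintegral => w _; apply: eq_bigr => i /fg ->.
- move=> B f g fg; rewrite /intersection_weight; case: ifP => // _; congr (fine (nu _)).
  by apply: eq_bigcapr => i /= /fg ->.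
apply: eq_bigr => B /andP[BS xB]; rewrite -ME; congr (_ * _).
rewrite /weighted_sum /intersection_weight; case: ifP => B2; last by rewrite big1// =>
  f _; rewrite mulr0.
(* A choice giving different atoms to two indices of [B] contributes 0; the constant choices add up
   to the measure of the intersection. *)
rewrite (bigID (fun f => [forall i in B, f i == f x]))/= [X in _ + X]big1 ?addr0;
  last first.
  move=> f /andP[_ /forall_inPn[i iB fix_]].
  rewrite (_ : \bigcap_(i in _) _ = set0) ?measure0 ?mulr0//; apply/seteqP; split => // z H.
  have zx : atom (f x) z by apply: H.
  have zi : atom (f i) z by apply: H.
  by case/eqP: fix_; exact: (atom_trivIset Logic.I Logic.I (ex_intro _ z (conj zi zx))).
rewrite (fine_measure_linear (a := fun U : {set I} => (B \subset U)%:R) (A := atom));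
  first last.
- by move=> z; exact: (indic_intersection_atoms _ xB).
- by move=> U; exact: (atom_finite_sets U).2.
- by move=> U; exact: (atom_finite_sets U).1.
- apply: fin_bigcap_measurable => [|i _]; first exact: finite_finset.
  exact: (D_fin i).1.
rewrite (reindex_onto (fun U : {set I} => [ffun i =>
  if i \in B then U else finset.set0] : {ffun I -> {set I}})
  (fun f => f x))/=; last first.
  move=> f /andP[/supportedP fB /forall_inP fx]; apply/ffunP => i; rewrite ffunE.
  by case: ifPn => [/fx/eqP//|/fB].
apply: eq_big => [U|U _].
  rewrite ffunE xB eqxx andbT; apply/andP; split.
    by apply/supportedP => i iB; rewrite ffunE (negbTE iB).
  by apply/forall_inP => i iB; rewrite !ffunE iB ?xB eqxx.
congr (_ * fine (nu _)).
  have [BU|/subsetPn[i iB iU]] := boolP (B \subset U).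
    by rewrite big1// => i iB; rewrite ffunE iB /a (fintype.subsetP BU).
  by rewrite (bigD1 i)//= ffunE iB /a (negbTE iU) mul0r.
apply/seteqP; split => [z /(_ x xB)|z zU i /= iB]; first by rewrite /= ffunE xB.
by rewrite ffunE iB.
Qed.

Lemma compensated_poisson_moment_formula S :
  \int[P]_w (\prod_(i in S) N (D i) w) = partition_sum (intersection_weight D) S.
Proof.
apply: (partition_sum_unique (M := fun S => \int[P]_w (\prod_(i in S) N (D i) w))).
  under eq_Rintegral do rewrite big_set0.
  exact: Rintegral_probability_cst.
exact: compensated_poisson_moment_rec_sets.
Qed.

End general_sets.
End compensated_poisson_moments.

(** * Multiple integrals of elementary functions *)

Section elementary_functions.
Context dO (Omega : measurableType dO) (R : realType) (P : probability Omega R).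
Context dZ (Z : measurableType dZ) (nu : {measure set Z -> \bar R}).
Context (N : set Z -> {RV P >-> R}) (m : nat).

(** The [C i] being disjoint, a point fits the box of at most one permutation, so the indicator of
    the union is a sum. *)
Lemma indic_symmetric_box (C : 'I_m -> set Z) (z : m.-tuple Z) :
  trivIset [set: 'I_m] C ->
  \1_(symmetric_box C) z = \sum_(w : 'S_m) \prod_i \1_(C (w i)) (tnth z i) :> R.
Proof.
move=> tC; rewrite indicE; have [[w0 _ zw0]|nz] := pselect (symmetric_box C z).
  rewrite mem_set; last by exists w0.
  rewrite (bigD1 w0)//= big1 => [|i _]; last by rewrite indicE mem_set//; exact: zw0.
  rewrite big1 ?addr0// => w ww0.
  have [i wi] : exists i, w i != w0 i.
    by apply/existsP; rewrite -negb_forall; apply: contra ww0 => /forallP H;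
      apply/eqP/permP => i; apply/eqP.
  rewrite (bigD1 i)//= indicE memNset ?mul0r// => Cw.
  by case/eqP: wi; apply: tC => //; exists (tnth z i); split => //; exact: zw0.
rewrite memNset// big1// => w _; apply/eqP; rewrite prodf_seq_eq0.
have /existsNP[i Ci] : ~ forall i, C (w i) (tnth z i).
  by move=> H; apply: nz; exists w.
by apply/hasP; exists i; [rewrite mem_index_enum|rewrite /= indicE memNset].
Qed.

Context (I : (m.-tuple Z -> R) -> {RV P >-> R}).
Hypothesis I_integral : is_multiple_integral nu N I.

Lemma multiple_integral_sum (r : nat) (a : 'I_r -> R) (C : 'I_r -> 'I_m -> set Z) :
  (forall l, admissible nu (C l)) ->
  {ae P, forall w, I (fun z => \sum_(l < r) a l * \1_(symmetric_box (C l)) z) w =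
    \sum_(l < r) a l * (m`!%:R * \prod_(i < m) N (C l i) w)}.
Proof.
have el (r' : nat) (a' : 'I_r' -> R) (C' : 'I_r' -> 'I_m -> set Z) :
    (forall l, admissible nu (C' l)) ->
    elementary_symmetric nu (fun z => \sum_(l < r') a' l * \1_(symmetric_box (C' l)) z : R).
  by move=> C'a; exists r', a', C'.
elim: r a C => [|r IH] a C Cadm.
  have e0 : elementary_symmetric nu (fun z : m.-tuple Z => 0 : R).
    by exists 0%N, (fun=> 0), (fun _ _ => set0); split=> [[]//|z]; rewrite big_ord0.
  (* Linearity for [1 * 0 + 0] gives I 0 = I 0 + I 0 almost surely, hence I 0 = 0. *)
  have := multiple_integral_linear I_integral 1 e0 e0.
  apply: filterS => w; rewrite big_ord0.
  rewrite (_ : (fun z => 1 * 0 + 0) = fun=> 0); last by apply/funext => z;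
    rewrite mulr0 addr0.
  rewrite (_ : (fun z : m.-tuple Z => \sum_(l < 0) _) = fun=> 0); last first.
    by apply/funext => z; rewrite big_ord0.
  by rewrite mul1r; lra.
have e1 : elementary_symmetric nu (\1_(symmetric_box (C ord_max)) : m.-tuple Z -> R).
  exists 1%N, (fun=> 1), (fun=> C ord_max); split=> // z.
  by rewrite big_ord1 mul1r.
have wadm l : admissible nu (C (widen_ord (leqnSn r) l)) by [].
have := multiple_integral_linear I_integral (a ord_max) e1
  (el _ (fun l => a (widen_ord (leqnSn r) l)) _ wadm).
have := multiple_integral_box I_integral (Cadm ord_max).
have := IH (fun l => a (widen_ord (leqnSn r) l)) _ wadm.
apply: filterS3 => w H1 H2 H3.
rewrite big_ord_recr/= -H1 -H2 addrC -H3; congr (I _ w).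
by apply/funext => z; rewrite big_ord_recr/= addrC.
Qed.

Lemma elementary_expansion (f : m.-tuple Z -> R) : elementary_symmetric nu f ->
  exists (r : nat) (a : nat -> R) (D : nat -> 'I_m -> set Z),
  (forall l, admissible nu (D l)) /\
  forall r', (r <= r')%N ->
    (forall z, f z = \sum_(l < r') a l * \prod_i \1_(D l i) (tnth z i)) /\
    {ae P, forall w, I f w = \sum_(l < r') a l * \prod_i N (D l i) w}.
Proof.
move=> [r [a [C [Cadm fE]]]].
pose E := ('I_r * 'S_m)%type.
pose DE (e : E) i := C e.1 (e.2 i).
have DEadm e : admissible nu (DE e).
  have [Cf Ct] := Cadm e.1; split=> [i|]; first exact: Cf.
  by move=> i j _ _ ij; apply: (@perm_inj _ e.2); exact: Ct.
(* [en] decodes a number into a term; past the last one it is [None], read as coefficient 0 and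
   empty sets. *)
pose en l : option E := omap enum_val (insub l : option 'I_#|{: E}|).
exists #|{: E}|, (fun l => oapp (fun e : E => a e.1) 0 (en l)),
  (fun l => oapp DE (fun=> set0) (en l)); split.
  move=> l; case: (en l) => [e|] //=; split => [i|i j _ _ [z []]//].
  by split; [exact: measurable0|rewrite measure0].
have key r' (G : ('I_m -> set Z) -> R) : (#|{: E}| <= r')%N ->
    \sum_(l < r') oapp (fun e : E => a e.1) 0 (en l) * G (oapp DE (fun=> set0) (en l)) =
    \sum_(l < r) \sum_(w : 'S_m) a l * G (fun i => C l (w i)).
  move=> rr'; pose h l := oapp (fun e : E => a e.1) 0 (en l) * G (oapp DE (fun=> set0)
    (en l)).
  rewrite (bigID (fun l : 'I_r' => (l < #|{: E}|)%N))/= addrC big1 ?add0r; last first.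
    by move=> l /negbTE El; rewrite /en insubF//= mul0r.
  rewrite -(big_ord_widen r' h rr') pair_big/= [RHS](reindex _ (onW_bij _
    (@enum_val_bij E)))/=.
  by apply: eq_bigr => i _; rewrite /h /en valK.
move=> r' rr'; split.
  move=> z; rewrite (key r' (fun D => \prod_i \1_(D i) (tnth z i)))// fE.
  apply: eq_bigr => l _; rewrite indic_symmetric_box ?mulr_sumr//.
  exact: (Cadm l).2.
rewrite (_ : f = fun z => \sum_(l < r) a l * \1_(symmetric_box (C l)) z); last exact/funext.
apply: filterS (multiple_integral_sum a Cadm) => w ->.
rewrite (key r' (fun D => \prod_i N (D i) w))//; apply: eq_bigr => l _.
rewrite -mulr_sumr; congr (_ * _).
rewrite [RHS](eq_bigr (fun=> \prod_i N (C l i) w)).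
  by rewrite sumr_const card_Sn mulr_natl.
by move=> s _; rewrite [RHS](reindex_inj (@perm_inj _ s)).
Qed.

End elementary_functions.

(** * The indices of the factors and the partition [consecutive_blocks] *)

Section consecutive_blocks.
Context (k : nat) (n_ : 'I_k -> nat).
Local Notation T := 'I_(\sum_(j < k) n_ j).
Implicit Types (x y : T) (s : {set {set T}}).

Lemma prod_sig (R : comNzRingType) (S : {set 'I_k}) (F : forall j, 'I_(n_ j) -> R) :
  \prod_(j in S) \prod_l F j l =
  \prod_(i in tagnat.sig1 @^-1: S) F (tagnat.sig1 i) (tagnat.sig2 i).
Proof.
rewrite (sig_big_dep (J := fun j => 'I_(n_ j)) _ (fun _ => xpredT) (@F))/=.
rewrite (reindex tagnat.sig)/=; last exact: onW_bij tagnat.sig_bij.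
by apply: eq_big => [i|//]; rewrite inE andbT.
Qed.

Lemma mem_consecutive_block j x :
  (x \in [set tagnat.Rank j l | l : 'I_(n_ j)]%SET) = (tagnat.sig1 x == j).
Proof.
apply/imsetP/eqP => [[l _ ->]|<-]; first exact: tagnat.Rank1K.
by exists (tagnat.sig2 x); rewrite ?inE// tagnat.sig2K.
Qed.

Lemma consecutive_blocks_partition : (forall j, 0 < n_ j)%N ->
  finset.partition (consecutive_blocks n_) [set: T]%SET.
Proof.
move=> n0; apply/and3P; split.
- apply/eqP/finset.setP => x; rewrite inE; apply/bigcupP.
  exists [set tagnat.Rank (tagnat.sig1 x) l | l : 'I_(n_ (tagnat.sig1 x))]%SET.
    by apply/imsetP; exists (tagnat.sig1 x).
  by rewrite mem_consecutive_block.
- apply/finset.trivIsetP => _ _ /imsetP[j _ ->] /imsetP[j' _ ->] jj'.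
  apply/pred0P => x /=; rewrite !mem_consecutive_block.
  by apply/negP => /andP[/eqP xj /eqP xj']; move: jj'; rewrite -xj -xj' eqxx.
- apply/negP => /imsetP[j _] /esym/eqP; apply/negP/set0Pn.
  by exists (tagnat.Rank j (Ordinal (n0 j))); rewrite mem_consecutive_block tagnat.Rank1K.
Qed.

Lemma pblock_consecutive_blocks x y : (forall j, 0 < n_ j)%N ->
  (y \in finset.pblock (consecutive_blocks n_) x) = (tagnat.sig1 x == tagnat.sig1 y).
Proof.
move=> n0; have /and3P[_ tri _] := consecutive_blocks_partition n0.
rewrite (@def_pblock _ _ [set tagnat.Rank (tagnat.sig1 x) l | l : 'I_(n_ (tagnat.sig1
  x))]%SET)//.
- by rewrite mem_consecutive_block eq_sym.
- by apply/imsetP; exists (tagnat.sig1 x).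
- by rewrite mem_consecutive_block.
Qed.

(** Provides a block containing two indices of one factor, which will force the weight of [s] to
    vanish. *)
Lemma partition_meet_neq_bot s : (forall j, 0 < n_ j)%N ->
  finset.partition s [set: T]%SET ->
  partition_meet s (consecutive_blocks n_) != partition_bot ->
  exists b x y, [/\ b \in s, x \in b, y \in b, x != y & tagnat.sig1 x = tagnat.sig1 y].
Proof.
move=> n0 sT; have pT := consecutive_blocks_partition n0.
have [/eqP cov tri s0] := and3P sT; have [/eqP covp trip p0] := and3P pT.
move=> meet; apply: contrapT => H; case/negP: meet; apply/eqP.
have one x y : y \in finset.pblock s x -> tagnat.sig1 x = tagnat.sig1 y -> x = y.
  move=> yx xy; apply: contrapT => /eqP nxy; apply: H.
  exists (finset.pblock s x), x, y; split => //; first by rewrite pblock_mem// cov.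
  by rewrite mem_pblock cov.
apply/finset.setP => c; apply/idP/imsetP.
  rewrite !inE => /andP[c0 /imset2P[b b' bs bp cE]].
  have [x xc] := set0Pn _ c0; exists x => //.
  have : x \in b :&: b' by rewrite -cE.
  rewrite inE => /andP[xb xb'].
  rewrite cE -(def_pblock tri bs xb) -(def_pblock trip bp xb').
  apply/finset.setP => y; rewrite !inE pblock_consecutive_blocks//.
  apply/andP/eqP => [[yx /eqP xy]|->]; first exact/esym/one.
  by rewrite mem_pblock cov.
move=> [x _ ->]; rewrite !inE; apply/andP; split; first by apply/set0Pn; exists x;
  rewrite set11.
apply/imset2P; exists (finset.pblock s x) (finset.pblock (consecutive_blocks n_) x).
- by rewrite pblock_mem// cov.
- by rewrite pblock_mem// covp.
apply/finset.setP => y; rewrite !inE pblock_consecutive_blocks//.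
apply/eqP/andP => [->|[yx /eqP xy]]; last exact/esym/one.
by rewrite mem_pblock cov.
Qed.

End consecutive_blocks.

(** * Integrals of functions with identified variables *)

Section identified_integrals.
Context (R : realType) (Z : ptopologicalType).
Context (nu : {sigma_finite_measure set (borel Z) -> \bar R}).
Context (k : nat) (n_ : 'I_k -> nat) (r : nat).
Context (a : 'I_k -> 'I_r -> R) (D : forall j, 'I_r -> 'I_(n_ j) -> set (borel Z)).
Context (f : forall j : 'I_k, (n_ j).-tuple (borel Z) -> R).
Arguments D : clear implicits.
Arguments f : clear implicits.
Hypothesis D_fin : forall j l i, finite_sets nu (D j l i).
Hypothesis fE : forall j z, f j z = \sum_(l < r) a j l * \prod_i \1_(D j l i) (tnth z i).
Local Notation T := 'I_(\sum_(j < k) n_ j).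
Implicit Types (s : {set {set T}}) (e : {ffun 'I_k -> 'I_r}).

(** A label [e] picks one product term in each factor; the sets of the chosen terms are listed along
    all indices. *)
Definition labelled_sets e (i : T) : set (borel Z) :=
  D (tagnat.sig1 i) (e (tagnat.sig1 i)) (tagnat.sig2 i).

Lemma labelled_sets_fin e i : finite_sets nu (labelled_sets e i).
Proof. exact: D_fin. Qed.

Lemma tensor_expansion (x : (\sum_(j < k) n_ j)%N.-tuple (borel Z)) :
  tensor f x = \sum_(e : {ffun 'I_k -> 'I_r}) (\prod_j a j (e j)) *
    \prod_i \1_(labelled_sets e i) (tnth x i).
Proof.
rewrite /tensor; under eq_bigr do rewrite fE.
rewrite bigA_distr_bigA; apply: eq_bigr => e _; rewrite big_split/=; congr (_ * _).
under eq_bigr do under eq_bigr do rewrite tnth_mktuple.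
rewrite [LHS](eq_bigl (fun j => j \in [set: 'I_k]%SET)); last by move=> j; rewrite inE.
rewrite (prod_sig [set: 'I_k]%SET (fun j l => \1_(D j (e j) l) (tnth x (tagnat.Rank j l)))).
by apply: eq_big => [i|i _]; rewrite ?inE// tagnat.sig2K.
Qed.

(** Once the variables of a block are identified, the indicators of its indices multiply to the
    indicator of an intersection. For fixed [e] the integrand is thus the indicator of a box with
    these intersections as sides. *)
Lemma integral_identify s : finset.partition s [set: T]%SET ->
  \int[power_measure nu #|s|]_y identify f (s := s) y =
  \sum_(e : {ffun 'I_k -> 'I_r}) (\prod_j a j (e j)) *
    \prod_(b in s) fine (nu (\bigcap_(i in [set` b]) labelled_sets e i)).
Proof.
move=> sT; have [/eqP cov tri s0] := and3P sT.
pose DB e (b : {set T}) := \bigcap_(i in [set` b]) labelled_sets e i.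
have mDB e b : measurable (DB e b).
  by apply: fin_bigcap_measurable => [|i _]; [exact: finite_finset|exact:
    (labelled_sets_fin e i).1].
have DBfin e b : b \in s -> (nu (DB e b) < +oo)%E.
  move=> bs; have /set0Pn[i ib] := partition_neq0 sT bs.
  apply: le_lt_trans (labelled_sets_fin e i).2.
  apply: le_measure; rewrite ?inE; [exact: mDB|exact: (labelled_sets_fin e i).1|].
  by move=> z; apply.
pose box e : set (#|s|.-tuple (borel Z)) :=
  [set y | forall q : 'I_#|s|, DB e (enum_val q) (tnth y q)].
have boxE e : power_measure nu #|s| (box e) = (\prod_(b in s) (fine (nu (DB e b))))%:E.
  rewrite /box (@power_measure_box _ _ _ nu #|s| (fun q => DB e (enum_val q)));
    last by move=> q; exact: mDB.
  rewrite (big_morph EFin EFinM erefl) [RHS]big_enum_val/=.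
  by apply: eq_bigr => q _; rewrite fineK// ge0_fin_numE// DBfin// enum_valP.
have index_val (i : T) : exists2 q : 'I_#|s|,
    index (finset.pblock s i) (enum s) = q & i \in enum_val q.
  have ps : finset.pblock s i \in s by rewrite pblock_mem// cov.
  have lt_s : (index (finset.pblock s i) (enum s) < #|s|)%N.
    by rewrite cardE index_mem mem_enum.
  exists (Ordinal lt_s) => //.
  by rewrite (enum_val_nth finset.set0) nth_index ?mem_enum// mem_pblock cov.
transitivity (\int[power_measure nu #|s|]_y (\sum_(e : {ffun 'I_k -> 'I_r}) (\prod_j a
  j (e j)) * \1_(box e) y)).
  apply: eq_Rintegral => y _; rewrite /identify tensor_expansion.
  apply: eq_bigr => e _; congr (_ * _).
  under eq_bigr do rewrite tnth_mktuple.
  rewrite indicE; have [yb|yb] := pselect (box e y).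
    rewrite mem_set// big1// => i _; have [q -> iq] := index_val i.
    by rewrite indicE mem_set// -tnth_nth; exact: (yb q i).
  (* A violated side [q] gives an index [i] of that block whose indicator is 0. *)
  rewrite memNset//; have /existsNP[q /existsNP[i /not_implyP[iq nD]]] := yb.
  rewrite (bigD1 i)//=; have [q' -> iq'] := index_val i.
  have <- : q = q'.
    apply: enum_val_inj.
    by rewrite -(def_pblock tri (enum_valP q) iq) (def_pblock tri (enum_valP q') iq').
  by rewrite -tnth_nth indicE memNset// mul0r.
rewrite Rintegral_sum_indic.
- by apply: eq_bigr => e _; congr (_ * _); exact: (congr1 fine (boxE e)).
- move=> e; rewrite (_ : box e = \bigcap_(q in [set: 'I_#|s|]) ((@tnth _ (borel Z) ^~
  q) @^-1` DB e (enum_val q))).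
    apply: fin_bigcap_measurable => // q _.
    by rewrite -[X in measurable X]setTI; exact: measurable_tnth.
  by apply/seteqP; split => y H q; [move=> _; exact: H|exact: (H q Logic.I)].
- by move=> e; apply: le_lt_trans (ltry _); rewrite le_eqVlt; apply/orP; left;
    apply/eqP; exact: boxE.
Qed.

End identified_integrals.

(** * Moments and cumulants of the multiple integrals *)

Section product_moments.
Context (R : realType) (Z : ptopologicalType).
Context (nu : {sigma_finite_measure set (borel Z) -> \bar R}).
Context (dO : measure_display) (Omega : measurableType dO) (P : probability Omega R).
Context (N : set (borel Z) -> {RV P >-> R}).
Hypothesis N_poisson : compensated_poisson_measure nu N.
Context (k : nat) (n_ : 'I_k -> nat) (r : nat).
Context (a : 'I_k -> 'I_r.+1 -> R)
  (D : forall j, 'I_r.+1 -> 'I_(n_ j) -> set (borel Z)).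
Context (X : 'I_k -> {RV P >-> R}).
Arguments D : clear implicits.
Hypothesis D_adm : forall j l, admissible nu (D j l).
Hypothesis XE : forall j,
  {ae P, forall w, X j w = \sum_(l < r.+1) a j l * \prod_i N (D j l i) w}.
Local Notation T := 'I_(\sum_(j < k) n_ j).
Local Notation blk := (@tagnat.sig1 k n_).
Implicit Types (S B : {set 'I_k}) (s : {set {set T}}) (e : {ffun 'I_k -> 'I_r.+1}).

Let D_fin j l i : finite_sets nu (D j l i). Proof. exact: (D_adm j l).1. Qed.

Let L e : T -> set (borel Z) := labelled_sets D e.
Let kappa e := intersection_weight nu (L e).

Let L_fin e i : finite_sets nu (L e i). Proof. exact: D_fin. Qed.

Let mN C : finite_sets nu C -> all_moments P (N C).
Proof. exact: compensated_poisson_all_moments. Qed.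

Lemma product_all_moments j : all_moments P (X j).
Proof.
apply: (all_moments_ae _ _ (XE j)) => //.
apply: all_moments_sum => l _; apply: all_momentsZ; apply: all_moments_prod => i _.
exact: mN.
Qed.

(** For each label the integrand is a product of values of [N] over the indices of the factors in
    [S], to which [compensated_poisson_moment_formula] applies. *)
Lemma product_moment S : \int[P]_w (\prod_(j in S) X j w) =
  weighted_sum ord0 a S (fun e => partition_sum (kappa e) (blk @^-1: S)).
Proof.
transitivity (\int[P]_w (weighted_sum ord0 a S
    (fun e => \prod_(i in blk @^-1: S) N (L e i) w))).
  apply: Rintegral_ae.
  - apply: (@all_moments_measurable _ _ _ P); apply: all_moments_prod => j _.
    exact: product_all_moments.
  - apply: (@all_moments_measurable _ _ _ P); apply: all_moments_sum => e _.
    by apply: all_momentsZ; apply: all_moments_prod => i _; exact: mN.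
  - have : {ae P, forall w j, X j w = \sum_(l < r.+1) a j l * \prod_i N (D j l i) w}.
      exact: filter_forall.
    apply: filterS => w H; under eq_bigr do rewrite H.
    rewrite (weighted_sum_prod ord0 a S (fun j l => \prod_i N (D j l i) w)).
    apply: eq_bigr => e _; congr (_ * _).
    exact: (prod_sig S (fun j l => N (D j (e j) l) w)).
rewrite Rintegral_fin_sum; last first.
  by move=> e _; apply: all_momentsZ; apply: all_moments_prod => i _; exact: mN.
apply: eq_bigr => e _; rewrite RintegralZl//; last first.
  by apply: all_moments_integrable; apply: all_moments_prod => i _; exact: mN.
by rewrite (compensated_poisson_moment_formula N_poisson (L_fin e)).
Qed.

Let L_inj e x y z : blk x = blk y -> L e x z -> L e y z -> x = y.
Proof.
(* Stated for dependent pairs, so that the equality of the factors can be substituted in the type of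
   the position. *)
suff pq (p q : {j & 'I_(n_ j)}) : tag p = tag q ->
    D (tag p) (e (tag p)) (tagged p) z -> D (tag q) (e (tag q)) (tagged q) z -> p = q.
  by move=> xy Lx Ly; apply: tagnat.sig_inj; exact: pq xy Lx Ly.
case: p q => [j l] [j' l'] /= jj'; rewrite -{}jj' in l' * => zl zl'.
by congr (Tagged _ _); apply: (D_adm j (e j)).2 => //; exists z.
Qed.

Let kappa_eq e e' B (b : {set T}) : {in B, e =1 e'} -> b \subset blk @^-1: B ->
  kappa e b = kappa e' b.
Proof.
move=> ee' bB; rewrite /kappa /intersection_weight; case: ifP => // _.
congr (fine (nu _)); apply: eq_bigcapr => i /= ib.
by rewrite /L /labelled_sets ee'//; have := fintype.subsetP bB i ib; rewrite inE.
Qed.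

(** This identifies the joint cumulants. For fixed labels the component of [j0] splits off; the
    weights being local, the recursion passes to the sum over labels. *)
Lemma product_moment_rec S j0 : j0 \in S -> \int[P]_w (\prod_(j in S) X j w) =
  \sum_(B : {set 'I_k} | (B \subset S) && (j0 \in B))
    weighted_sum ord0 a B (fun e => connected_sum blk (kappa e) B) *
    \int[P]_w (\prod_(j in S :\: B) X j w).
Proof.
move=> j0S; rewrite product_moment.
rewrite (@weighted_sum_rec _ _ _ _ _ (fun e => connected_sum blk (kappa e))
  (fun e B => partition_sum (kappa e) (blk @^-1: B)) _ j0).
- by apply: eq_bigr => B _; rewrite product_moment.
- move=> B e e' ee'; apply: eq_bigr => s /andP[sB _]; apply: eq_bigr => b bs.
  by apply: kappa_eq ee' _; exact: partitionS sB bs.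
- move=> B e e' ee'; apply: eq_bigr => s sB; apply: eq_bigr => b bs.
  by apply: kappa_eq ee' _; exact: partitionS sB bs.
- by move=> e; exact: partition_sum_connected.
Qed.

Hypothesis n_gt0 : forall j, (0 < n_ j)%N.
Context (f : forall j : 'I_k, (n_ j).-tuple (borel Z) -> R).
Arguments f : clear implicits.
Hypothesis fE : forall j z,
  f j z = \sum_(l < r.+1) a j l * \prod_i \1_(D j l i) (tnth z i).
Local Notation pi_star := (consecutive_blocks n_).
Let integral_of s := \int[power_measure nu #|s|]_y identify f (s := s) y.

(** [Q] is trivial for moments and connectedness for cumulants. Partitions outside
    [partitions_ge2_meet0] have weight 0 for every label; on the others each block weight is the
    measure found in [integral_identify]. *)
Lemma weighted_partition_sum (Q : pred {set {set T}}) :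
  \sum_(e : {ffun 'I_k -> 'I_r.+1}) (\prod_j a j (e j)) *
    \sum_(s | finset.partition s [set: T]%SET && Q s) \prod_(b in s) kappa e b =
  \sum_(s | (s \in partitions_ge2_meet0 pi_star) && Q s) integral_of s.
Proof.
under eq_bigr do rewrite mulr_sumr.
rewrite exchange_big/=.
rewrite (bigID (fun s => s \in partitions_ge2_meet0 pi_star))/=.
rewrite [X in _ + X]big1 ?addr0; last first.
  move=> s /andP[/andP[sT _]]; rewrite inE sT/= negb_and => /orP[meet|ge2].
    rewrite big1// => e _.
    have [b [x [y [bs xb yb xy xy1]]]] := partition_meet_neq_bot n_gt0 sT meet.
    rewrite (bigD1 b)//= [kappa e b](_ : _ = 0) ?mul0r ?mulr0//.
    rewrite /kappa /intersection_weight; case: ifP => // _.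
    rewrite (_ : \bigcap_(i in _) _ = set0) ?measure0//.
    by apply/seteqP; split => // z H; case/eqP: xy; exact: L_inj (H x xb) (H y yb).
  rewrite big1// => e _; have [b bs b2] := forall_inPn ge2.
  rewrite (bigD1 b)//= [kappa e b](_ : _ = 0) ?mul0r ?mulr0//.
  by rewrite /kappa /intersection_weight (negbTE b2).
apply: eq_big => [s|s /andP[/andP[sT _] sP]].
  rewrite inE; case: (finset.partition s _) => //=.
  by rewrite andbC.
rewrite /integral_of (integral_identify D_fin fE sT); apply: eq_bigr => e _.
congr (_ * _); apply: eq_bigr => b bs; rewrite /kappa /intersection_weight.
by move: sP; rewrite inE => /and3P[_ _ /forall_inP/(_ b bs) ->].
Qed.

End product_moments.

Theorem corollary7p2 (R : realType) (Z : ptopologicalType)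
    (Z_polish : polish R Z)
    (nu : {sigma_finite_measure set (borel Z) -> \bar R})
    (nu_non_atomic : non_atomic nu)
    (dO : measure_display) (Omega : measurableType dO)
    (P : probability Omega R)
    (N : set (borel Z) -> {RV P >-> R})
    (N_poisson : compensated_poisson_measure nu N)
    (I : forall m : nat, (m.-tuple (borel Z) -> R) -> {RV P >-> R})
    (I_integral : forall m : nat, (0 < m)%N -> is_multiple_integral nu N (I m))
    (k : nat) (k_gt0 : (0 < k)%N)
    (n_ : 'I_k -> nat) (n_gt0 : forall j, (0 < n_ j)%N)
    (f : forall j : 'I_k, (n_ j).-tuple (borel Z) -> R)
    (f_elementary : forall j, elementary_symmetric nu (f j)) :
  let pi_star := consecutive_blocks n_ in
  let chi := joint_cumulant P (fun j => I (n_ j) (f j) : Omega -> R) in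
  let moment := ('E_P[fun w => (\prod_(j < k) I (n_ j) (f j) w)%R])%E in
  let integral_of (s : {set {set 'I_(\sum_(j < k) n_ j)}}) :=
    \int[power_measure nu #|s|]_y identify f (s := s) y in
  [/\ partitions_ge2 pi_star = finset.set0 -> chi = 0,
      partitions_ge2 pi_star <> finset.set0 ->
        chi = (\sum_(s in partitions_ge2 pi_star) integral_of s)%:C,
      partitions_ge2_meet0 pi_star = finset.set0 -> moment = 0%E &
      partitions_ge2_meet0 pi_star <> finset.set0 ->
        moment = (\sum_(s in partitions_ge2_meet0 pi_star) integral_of s)%:E].
Proof.
move=> pi_star chi moment integral_of.
pose W j := (nat * (nat -> R) * (nat -> 'I_(n_ j) -> set (borel Z)))%type.
have H j : {t : W j | (forall l, admissible nu (t.2 l)) /\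
    forall r', (t.1.1 <= r')%N ->
    (forall z, f j z = \sum_(l < r') t.1.2 l * \prod_i \1_(t.2 l i) (tnth z i)) /\
    {ae P, forall w, I (n_ j) (f j) w = \sum_(l < r') t.1.2 l * \prod_i N (t.2 l i) w}}.
  apply: cid.
  have [r [a [D [Dadm DE]]]] := elementary_expansion (I_integral (n_ j) (n_gt0 j))
    (f_elementary j).
  by exists (r, a, D).
(* A common number of terms for all factors; the successor guarantees a label [ord0], the default
   value in the weighted sums. *)
pose r := \max_j (sval (H j)).1.1.
pose a j (l : 'I_r.+1) := (sval (H j)).1.2 l.
pose D j (l : 'I_r.+1) := (sval (H j)).2 l.
have rj j : ((sval (H j)).1.1 <= r.+1)%N by rewrite ltnW// ltnS (leq_bigmax j).
have D_adm j l : admissible nu (D j l) by exact: (svalP (H j)).1.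
have fE j : forall z, f j z = \sum_(l < r.+1) a j l * \prod_i \1_(D j l i) (tnth z i).
  exact: ((svalP (H j)).2 _ (rj j)).1.
have XE j : {ae P, forall w, I (n_ j) (f j) w = \sum_(l < r.+1) a j l * \prod_i N (D j
  l i) w}.
  exact: ((svalP (H j)).2 _ (rj j)).2.
have mX := product_all_moments N_poisson D_adm XE.
have x0 : 'I_(\sum_(j < k) n_ j).
  exact: (tagnat.Rank (Ordinal k_gt0) (Ordinal (n_gt0 _))).
(* The formula covers the case without partitions: the sum is then empty, which gives the vanishing
   statement. The same holds for [momentE]. *)
have chiE : chi = (\sum_(s in partitions_ge2 pi_star) integral_of s)%:C.
  rewrite /chi (joint_cumulant_recursion k_gt0 mX (product_moment_rec N_poisson D_adm XE)).
  congr (_ %:C); rewrite weighted_sumT.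
  rewrite (eq_bigl (fun s => (s \in partitions_ge2_meet0 pi_star) &&
      block_connected (@tagnat.sig1 k n_) [set: 'I_k]%SET s)).
    rewrite -(weighted_partition_sum D_adm n_gt0 fE).
    by apply: eq_bigr => e _; rewrite /connected_sum finset.preimsetT.
  move=> s; rewrite [LHS]inE.
  have [|//] := boolP (s \in partitions_ge2_meet0 _); rewrite inE => /and3P[sT _ _] /=.
  apply: (partition_join_connected x0) => //.
  - by move=> x y; exact: pblock_consecutive_blocks.
  - by move=> j; exists (tagnat.Rank j (Ordinal (n_gt0 j))); exact: tagnat.Rank1K.
have momentE : moment = (\sum_(s in partitions_ge2_meet0 pi_star) integral_of s)%:E.
  rewrite /moment unlock -EFin_Rintegral; last by apply: all_moments_prod => j _; exact: mX.
  congr (_%:E).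
  have := product_moment N_poisson D_adm XE [set: 'I_k]%SET.
  rewrite weighted_sumT finset.preimsetT.
  have -> : (\int[P]_w (\prod_(j in [set: 'I_k]%SET) I (n_ j) (f j) w) =
      \int[P]_w (\prod_(j < k) I (n_ j) (f j) w))%R.
    by apply: eq_Rintegral => w _; apply: eq_bigl => j; rewrite inE.
  move=> ->.
  transitivity (\sum_(s | (s \in partitions_ge2_meet0 pi_star) && true) integral_of s).
    rewrite -(weighted_partition_sum D_adm n_gt0 fE xpredT).
    by apply: eq_bigr => e _; congr (_ * _); apply: eq_bigl => s; rewrite andbT.
  by apply: eq_bigl => s; rewrite andbT.
split=> [s0||s0|]; rewrite ?chiE ?momentE//.
- by rewrite s0 big_set0.
- by rewrite s0 big_set0.
Qed.
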